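(* For a projective limit manifold $M=\varprojlim M_i$ there is a one-to-one correspondence between (linear) connections and sprays. Moreover, the geodesics of $\nabla$ are geodesic sprays of $\zeta$ (where $\nabla$ is a connection on $M$ and $\zeta$ is the spray assigned to $\nabla$).
   Context: Setting. $\{(M_i,\varphi_{ji})\}_{i,j\in\mathbb N}$ is a projective system of smooth Banach manifolds (connecting maps $\varphi_{ji}:M_j\to M_i$, $j\ge i$), where $M_i$ is modelled on the Banach space $\mathbb E_i$ and $\{\mathbb E_i,\rho_{ji}\}$ is a projective system of Banach spaces with continuous linear maps $\rho_{ji}:\mathbb E_j\to\mathbb E_i$ and limit the Fréchet space $\mathbb F=\varprojlim\mathbb E_i$. For each $m=(m_i)\in M=\varprojlim M_i$ there is a projective system of charts $(U_i,\varphi_i)$ of $M_i$ with $m_i\in U_i$ (so $\varphi_i\circ\varphi_{ji}=\rho_{ji}\circ\varphi_j$) and $U=\varprojlim U_i$ open in $M$. The pairs $(U=\varprojlim U_i,\varphi=\varprojlim\varphi_i)$ are the charts of the Fréchet manifold $M$. $\mathcal H^2(\mathbb F,\mathbb F)$ is the Fréchet space of sequences $(B_i)$ of continuous bilinear maps $B_i:\mathbb E_i\times\mathbb E_i\to\mathbb E_i$ for which $\varprojlim B_i$ exists, i.e. $B_i\circ(\rho_{ji}\times\rho_{ji})=\rho_{ji}\circ B_j$ for $j\ge i$. On Fréchet manifolds it replaces the space of bilinear maps of the model space. A (linear) connection on $M$ is a limit $\nabla=\varprojlim\nabla_i$ of connections $\nabla_i$ on $M_i$, given in every chart $(U=\varprojlim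 U_i,\varphi=\varprojlim\varphi_i)$ by a smooth map $\Gamma_\varphi=\varprojlim\Gamma_{\varphi_i}:\varphi(U)\to\mathcal H^2(\mathbb F,\mathbb F)$ through $(\nabla_XY)(\varphi m)=DY_\varphi(\varphi m).X_\varphi(\varphi m)-\Gamma_\varphi(\varphi m)(X_\varphi(\varphi m),Y_\varphi(\varphi m))$ for $m\in U$ and vector fields $X=\varprojlim X_i$, $Y=\varprojlim Y_i$ with local principal parts $X_\varphi$, $Y_\varphi$. A spray on $M$ is a second order vector field $\zeta=\varprojlim\zeta_i:TM\to TTM$, the limit of sprays $\zeta_i$ on $M_i$, determined in every chart by a smooth map $\Gamma_\varphi=\varprojlim\Gamma_{\varphi_i}$ on $\varphi(U)$, with symmetric values in $\mathcal H^2(\mathbb F,\mathbb F)$, through $[\zeta(v)]_\varphi(\varphi m,v_\varphi)=(v_\varphi,\Gamma_\varphi(\varphi m)(v_\varphi,v_\varphi))$ for $m\in U$, $v\in T_mM$ with local representative $v_\varphi$. The spray assigned to a connection $\nabla$ with local components $\Gamma_\varphi$ is the one given locally by $(v_\varphi,\Gamma_\varphi(\varphi m)(v_\varphi,v_\varphi))$. A curve $\gamma:(-\varepsilon,\varepsilon)\to M$ is a geodesic of $\nabla$ if $\nabla_{T\gamma}T\gamma=0$. It is a geodesic spray of $\zeta$ if $T\gamma$ is an integral curve of $\zeta$; locally, with $\gamma_\varphi=\varphi\circ\gamma$, $\gamma_\varphi''(t)=\Gamma_\varphi(\gamma_\varphi(t))(\gamma_\varphi'(t),\gamma_\varphi'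(t))$.
   Formalization: The one-to-one correspondence is between torsion-free (symmetric) connections and sprays, since connections differing by an antisymmetric term have the same spray; every connection still has exactly one assigned spray, and the geodesic claim covers all connections. *)

(* Defs.v *)
From HB Require Import structures.
From mathcomp Require Import all_boot all_order all_algebra.
From mathcomp Require Import all_classical all_reals all_analysis.
Set Implicit Arguments.
Unset Strict Implicit.
Unset Printing Implicit Defensive.
Import Order.TTheory GRing.Theory Num.Theory numFieldNormedType.Exports.
Local Open Scope classical_set_scope.
Local Open Scope ring_scope.

(* MathComp-Analysis has no normed space of continuous linear maps; [clin E F]
   is L(E, F) with the operator norm, so that [clin E (clin E F)] is the space
   of continuous bilinear maps E x E -> F. *)
Section ContinuousLinearMaps.
Context {R : realType} {E F : normedModType R}.

Definition clin_pred : {pred E -> F} :=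
  mem [set f : E -> F | linear f /\ continuous f].

Lemma clin_pred_closed : submod_closed clin_pred.
Proof.
split=> [|a f g].
  rewrite inE; split=> [c x y|x]; last exact: cst_continuous.
  by rewrite /= scaler0 addr0.
rewrite !inE => -[lf cf] [lg cg]; split=> [c x y|x].
  rewrite !fctE lf lg !scalerDr !scalerA [a * c]mulrC -!addrA; congr (_ + _).
  by rewrite addrCA.
by apply: continuousD; [apply: continuousZl_tmp; exact: cf|exact: cg].
Qed.

HB.instance Definition _ :=
  @GRing.isSubmodClosed.Build R (E -> F) clin_pred clin_pred_closed.

Record clin := Clin { clin_fun :> E -> F; _ : clin_fun \in clin_pred }.

HB.instance Definition _ := [isSub for clin_fun].
HB.instance Definition _ := [Choice of clin by <:].
HB.instance Definition _ := [SubChoice_isSubLmodule of clin by <:].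

Implicit Types f g : clin.

Definition opnorm f : R := sup [set `|f x| | x in [set x | `|x| <= 1]].

Lemma clinP f : linear f /\ continuous f.
Proof. by have := valP f; rewrite inE. Qed.

Let nonempty f : [set `|f x| | x in [set x | `|x| <= 1]] !=set0.
Proof. by exists `|f 0|, 0 => //=; rewrite normr0. Qed.

Let bounded f : has_ubound [set `|f x| | x in [set x | `|x| <= 1]].
Proof.
have [lf cf] := clinP f.
pose h := GRing.isLinear.Build R E F *:%R f lf.
pose L : {linear E -> F} := HB.pack (clin_fun f) h.
have /linear_boundedP : bounded_near L (nbhs 0).
  exact/linear_bounded_continuous.
move=> /pinfty_ex_gt0 [M M0 ML]; exists M => _ [x /= x1 <-].
by rewrite (le_trans (ML x))// ler_piMr// ltW.
Qed.

Lemma le_opnorm f x : `|x| <= 1 -> `|f x| <= opnorm f.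
Proof. by move=> x1; apply: ub_le_sup => //; exists x. Qed.

Lemma opnormD f g : opnorm (f + g) <= opnorm f + opnorm g.
Proof.
apply: ge_sup => // _ [x /= x1 <-].
by rewrite (le_trans (ler_normD _ _))// lerD// le_opnorm.
Qed.

Lemma opnormZ (a : R) f : opnorm (a *: f) = `|a| * opnorm f.
Proof.
have le b h : opnorm (b *: h) <= `|b| * opnorm h.
  apply: ge_sup => // _ [x /= x1 <-].
  by rewrite normrZ ler_wpM2l// le_opnorm.
apply/eqP; rewrite eq_le le/=.
have [->|a0] := eqVneq a 0.
  rewrite normr0 mul0r (le_trans _ (le_opnorm (0 *: f) (x := 0) _)) ?normr0//.
have := le a^-1 (a *: f); rewrite scalerA mulVf// scale1r.
by rewrite normfV ler_pdivlMl// normr_gt0.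
Qed.

Lemma opnorm0_eq0 f : opnorm f = 0 -> f = 0.
Proof.
move=> f0; apply/val_inj/funext => x /=.
have [lf _] := clinP f.
have fZ a y : f (a *: y) = a *: f y.
  pose h := GRing.isLinear.Build R E F *:%R f lf.
  pose L : {linear E -> F} := HB.pack (clin_fun f) h.
  exact: (linearZ_LR L).
have [->|x0] := eqVneq x 0; first by rewrite -(scale0r 0) fZ scale0r.
have := @le_opnorm f (`|x|^-1 *: x).
rewrite normrZ normfV normr_id mulVf ?normr_eq0// lexx => /(_ isT).
rewrite f0 normr_le0 fZ scaler_eq0 invr_eq0 normr_eq0 (negbTE x0) /=.
by move/eqP.
Qed.

HB.instance Definition _ :=
  Lmodule_isNormed.Build R clin opnormD opnormZ opnorm0_eq0.

End ContinuousLinearMaps.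
Arguments clin {R} E F.

Definition bilin (R : realType) (E : normedModType R) : normedModType R :=
  clin E (clin E E).

(* The default value 0 is used only where 'd f x is not continuous, that is
   never at a point where f is differentiable. *)
Definition Deriv (R : realType) (E F : normedModType R) (f : E -> F) (x : E) :
  clin E F := insubd (0 : clin E F) ('d f x : E -> F).

(* Only meant for open sets S: the derivatives are taken in E. *)
Fixpoint Ck_on (R : realType) (E F : normedModType R) (n : nat) (S : set E)
    (f : E -> F) : Prop :=
  match n with
  | 0 => forall x, S x -> {for x, continuous f}
  | n'.+1 => (forall x, S x -> differentiable f x) /\ Ck_on n' S (Deriv f)
  end.

Definition smooth_on (R : realType) (E F : normedModType R) (S : set E)
  (f : E -> F) : Prop := forall n, Ck_on n S f.

Record chart (R : realType) (E : normedModType R) (M : topologicalType) :=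
  Chart { cdom : set M; cmap : M -> E; cinv : E -> M }.

Section Charts.
Context {R : realType} {E : normedModType R} {M : topologicalType}.
Implicit Types c d : chart E M.

Definition is_chart c :=
  [/\ open (cdom c) /\ open (cmap c @` cdom c),
      forall m, cdom c m -> cinv c (cmap c m) = m,
      forall m, cdom c m -> {for m, continuous (cmap c)}
    & forall m, cdom c m -> {for cmap c m, continuous (cinv c)}].

Definition ctrans c d : E -> E := cmap d \o cinv c.

Definition compatible c d :=
  smooth_on (cmap c @` (cdom c `&` cdom d)) (ctrans c d).

End Charts.

Record banach_manifold (R : realType) (E : completeNormedModType R) :=
  BanachManifold {
    carrier :> topologicalType;
    atlas : set (chart E carrier);
    atlas_chart : forall c, atlas c -> is_chart c;
    atlas_cover : forall m, exists2 c, atlas c & cdom c m;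
    atlas_compatible : forall c d, atlas c -> atlas d -> compatible c d;
    atlas_max : forall c, is_chart c ->
      (forall d, atlas d -> compatible c d /\ compatible d c) -> atlas c
  }.

(* The data of a manifold from which its tangent bundle is made: points,
   domains and coordinates of the charts, and transition maps.  [Tan] below can
   be applied twice, which gives TTM. *)
Record coords (R : realType) := Coords {
  pt : Type;
  mdl : normedModType R;
  idx : Type;
  dom : idx -> set pt;
  loc : idx -> pt -> mdl;
  trans : idx -> idx -> mdl -> mdl
}.

Definition coords_of (R : realType) (E : completeNormedModType R)
    (M : banach_manifold E) : coords R :=
  @Coords R M E {c | atlas (b := M) c} (fun c => cdom (sval c))
    (fun c => cmap (sval c)) (fun c d => ctrans (sval c) (sval d)).

(* A tangent vector is an equivalence class of triples (chart i, m, u) under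
   (i, m, u) ~ (j, m, D(trans i j)(loc i m) u).  Such a class has exactly one
   representative [rep i] in each chart at [foot]; the value 0 elsewhere makes
   the encoding of the class unique. *)
Record tangent (R : realType) (A : coords R) := Tangent {
  foot : pt A;
  rep : idx A -> mdl A;
  rep_trans : forall i j, dom i foot -> dom j foot ->
    rep j = 'd (trans i j) (loc i foot) (rep i);
  rep_out : forall i, ~ dom i foot -> rep i = 0
}.

Definition Tmap (R : realType) (E F : normedModType R) (f : E -> F)
  (p : E * E) : F * F := (f p.1, 'd f (p.1) p.2).

Definition Tan (R : realType) (A : coords R) : coords R :=
  @Coords R (tangent A) (mdl A * mdl A)%type (idx A)
    (fun i v => dom i (foot v)) (fun i v => (loc i (foot v), rep v i))
    (fun i j => Tmap (trans i j)).

(* A smooth map, given by its graph and its expressions in charts. *)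
Record cmor (R : realType) (A B : coords R) := Cmor {
  graph : pt A -> pt B -> Prop;
  mloc : idx A -> idx B -> mdl A -> mdl B
}.

Definition Tmor (R : realType) (A B : coords R) (f : cmor A B) :
    cmor (Tan A) (Tan B) :=
  @Cmor R (Tan A) (Tan B)
    (fun v w => graph f (foot v) (foot w) /\
      forall i j, dom i (foot v) -> dom j (foot w) ->
        rep w j = 'd (mloc f i j) (loc i (foot v)) (rep v i))
    (fun i j => Tmap (mloc f i j)).

(* w is the velocity (T c)(d/dt) of the curve c at time t. *)
Definition velocity (R : realType) (A : coords R) (c : R -> pt A) (t : R)
    (w : tangent A) : Prop :=
  foot w = c t /\
  forall i, dom i (c t) -> is_derive t 1 (fun s => loc i (c s)) (rep w i).

Section ManifoldMaps.
Context {R : realType}.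

Definition map_mor (E F : completeNormedModType R) (M : banach_manifold E)
    (N : banach_manifold F) (f : M -> N) : cmor (coords_of M) (coords_of N) :=
  @Cmor R (coords_of M) (coords_of N) (fun x y => f x = y)
    (fun c d => cmap (sval d) \o f \o cinv (sval c)).

Definition smooth_map (E F : completeNormedModType R) (M : banach_manifold E)
    (N : banach_manifold F) (f : M -> N) : Prop :=
  continuous f /\
  forall (c : chart E M) (d : chart F N), atlas c -> atlas d ->
    smooth_on (cmap c @` (cdom c `&` f @^-1` cdom d))
              (cmap d \o f \o cinv c).

Definition smooth_curve (E : completeNormedModType R) (M : banach_manifold E)
    (J : set R) (c : R -> M) : Prop :=
  (forall t, J t -> {for t, continuous c}) /\
  forall d : chart E M, atlas d -> smooth_on (J `&` c @^-1` cdom d) (cmap d \o c).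

End ManifoldMaps.

Section BanachLevel.
Context {R : realType} {E : completeNormedModType R}.
Variable M : banach_manifold E.

Notation TM := (tangent (coords_of M)).
Notation TTM := (tangent (Tan (coords_of M))).

(* Sections of TM over W, extended by the zero vectors outside W. *)
Record vsection (W : set M) := VSection {
  vs :> M -> TM;
  vs_foot : forall m, foot (vs m) = m;
  vs_out : forall m, ~ W m -> forall c, rep (vs m) c = 0
}.

Definition ppart (X : M -> TM) (c : idx (coords_of M)) (x : E) : E :=
  rep (X (cinv (sval c) x)) c.

(* A vector field on the open set W; smoothness near m is required in one chart
   at m, hence holds in all of them. *)
Record vfield (W : set M) := VField {
  vf :> vsection W;
  vf_open : open W;
  vf_smooth : forall m, W m -> exists2 c : idx (coords_of M), dom c m &
    smooth_on (loc c @` (dom c `&` W)) (ppart vf c)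
}.

(* Banach manifolds need not have bump functions, so that nabla must be given
   on the vector fields of every open set, as a morphism of sheaves. *)
Definition nabla_op := forall W : set M, vfield W -> vfield W -> vsection W.

(* The smoothness of nabla_X Y, its bilinearity and the Leibniz rule are
   consequences of the local formula. *)
Definition conn_components (D : nabla_op) (c : idx (coords_of M))
    (G : E -> bilin E) : Prop :=
  smooth_on (loc c @` dom c) G /\
  forall (W : set M) (X Y : vfield W) (m : M), W m -> dom c m ->
    rep (D W X Y m) c =
      'd (ppart Y c) (loc c m : E) (rep (X m) c)
      - G (loc c m) (rep (X m) c) (rep (Y m) c).

Definition is_connection (D : nabla_op) : Prop :=
  forall c, exists G, conn_components D c G.

Definition spray_components (z : TM -> TTM) (c : idx (coords_of M))
    (G : E -> bilin E) : Prop :=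
  [/\ smooth_on (loc c @` dom c) G,
      forall m, dom c m -> forall u v, G (loc c m) u v = G (loc c m) v u
    & forall v : TM, dom c (foot v) ->
        rep (z v) c = (rep v c, G (loc c (foot v)) (rep v c) (rep v c))].

Definition is_spray (z : TM -> TTM) : Prop :=
  (forall v, foot (z v) = v) /\ forall c, exists G, spray_components z c G.

End BanachLevel.

(* Projective limits of sequences, for bonding maps given by their graphs. *)
Record plim (A : nat -> Type) (b : forall j i, A j -> A i -> Prop) := PLim {
  pfun :> forall i, A i;
  pfunP : forall i j, (i <= j)%N -> b j i (pfun j) (pfun i)
}.

Definition plim_open (A : nat -> topologicalType)
    (b : forall j i, A j -> A i -> Prop) (U : set (plim b)) : Prop :=
  exists2 O : set (prod_topology A), open O & U = (@pfun A b) @^-1` O.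

Record proj_system (R : realType) := ProjSystem {
  mspace : nat -> completeNormedModType R;
  rho : forall j i, mspace j -> mspace i;
  rho_linear : forall i j, (i <= j)%N -> linear (@rho j i);
  rho_continuous : forall i j, (i <= j)%N -> continuous (@rho j i);
  rho_id : forall i x, @rho i i x = x;
  rho_comp : forall i j k, (i <= j)%N -> (j <= k)%N -> forall x,
    @rho j i (@rho k j x) = @rho k i x;
  mani : forall i, banach_manifold (mspace i);
  bond : forall j i, mani j -> mani i;
  bond_smooth : forall i j, (i <= j)%N -> smooth_map (@bond j i);
  bond_id : forall i m, @bond i i m = m;
  bond_comp : forall i j k, (i <= j)%N -> (j <= k)%N -> forall m,
    @bond j i (@bond k j m) = @bond k i m
}.

Section LimitSpaces.
Context {R : realType}.
Variable S : proj_system R.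

Notation E := (mspace S).
Notation Mi i := (coords_of (mani S i)).

Definition LF : Type :=
  plim (A := E) (fun j i x y => @rho R S j i x = y).

Definition LM : Type :=
  plim (A := fun i => mani S i) (fun j i => graph (map_mor (@bond R S j i))).

Definition LT : Type :=
  plim (A := fun i => tangent (Mi i))
    (fun j i => graph (Tmor (map_mor (@bond R S j i)))).

Definition LTT : Type :=
  plim (A := fun i => tangent (Tan (Mi i)))
    (fun j i => graph (Tmor (Tmor (map_mor (@bond R S j i))))).

Definition bilin_bond j i (B : bilin (E j)) (C : bilin (E i)) : Prop :=
  forall u v, C (@rho R S j i u) (@rho R S j i v) = @rho R S j i (B u v).

Definition H2 : Type := plim (A := fun i => bilin (E i)) bilin_bond.

Definition lfoot (v : LT) : LM :=
  PLim (fun i j (le_ij : (i <= j)%N) => proj1 (pfunP v le_ij)).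

(* A projective system of charts (U_i, phi_i) such that U = lim U_i is open in
   M and phi(U) is open in F, that is, a chart of the Frechet manifold M. *)
Record lchart := LChart {
  lc :> forall i, idx (Mi i);
  lc_bond : forall i j, (i <= j)%N -> forall m : mani S j, dom (lc j) m ->
    dom (lc i) (@bond R S j i m) /\
    loc (lc i) (@bond R S j i m) = @rho R S j i (loc (lc j) m);
  lc_open : plim_open [set m : LM | forall i, dom (lc i) (m i)];
  lc_img_open : plim_open [set x : LF | exists2 m : LM,
    (forall i, dom (lc i) (m i)) & forall i, x i = loc (lc i) (m i)]
}.

Definition ldom (c : lchart) : set LM := [set m | forall i, dom (c i) (m i)].

Definition at_point (c : lchart) (m : LM) (x : LF) : Prop :=
  forall i, x i = loc (c i) (m i).

End LimitSpaces.

Record proj_manifold (R : realType) := ProjManifold {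
  psys :> proj_system R;
  lchart_at : forall m : LM psys, exists c : lchart psys, ldom c m
}.

Section LimitLevel.
Context {R : realType}.
Variable M : proj_manifold R.

Notation E := (mspace M).
Notation Mi i := (mani M i).
Notation CMi i := (coords_of (mani M i)).
Notation F := (LF M).
Notation TM := (LT M).
Notation TTM := (LTT M).

(* Gamma = lim Gamma_i on phi(U).  The maps Gamma_i are smooth by
   [conn_components] and [spray_components]; since F and H^2(F,F) carry the
   limit topologies this is the smoothness of Gamma. *)
Definition is_lim_gamma (c : lchart M) (Gi : forall i, E i -> bilin (E i))
    (G : F -> H2 M) : Prop :=
  (forall i j, (i <= j)%N -> forall m : Mi j, dom (c j) m ->
     bilin_bond (Gi j (loc (c j) m)) (Gi i (@rho R M j i (loc (c j) m)))) /\
  (forall m, ldom c m -> forall x, at_point c m x ->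
     forall i, G x i = Gi i (x i)).

Record lsection (W : set (LM M)) := LSection {
  ls :> LM M -> TM;
  ls_foot : forall m, lfoot (ls m) = m;
  ls_out : forall m, ~ W m -> forall i c, rep (ls m i) c = 0
}.

(* X = lim X_i on W = lim W_i. *)
Definition is_lim_field (W : set (LM M)) (Wi : forall i, set (Mi i))
    (Xi : forall i, vfield (Wi i)) (X : lsection W) : Prop :=
  [/\ W = [set m | forall i, Wi i (m i)],
      forall i j, (i <= j)%N -> forall m : Mi j, Wi j m ->
        Wi i (@bond R M j i m) /\
        graph (Tmor (map_mor (@bond R M j i))) (Xi j m) (Xi i (@bond R M j i m))
    & forall m, W m -> forall i, X m i = Xi i (m i)].

Record lfield (W : set (LM M)) := LField {
  lf :> lsection W;
  lf_open : plim_open W;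
  lf_lim : exists Wi (Xi : forall i, vfield (Wi i)), is_lim_field Xi lf
}.

Definition lnabla_op :=
  forall W : set (LM M), lfield W -> lfield W -> lsection W.

Definition is_lim_nabla (N : lnabla_op) (D : forall i, nabla_op (Mi i)) :=
  forall W (X Y : lfield W) Wi (Xi Yi : forall i, vfield (Wi i)),
    is_lim_field Xi X -> is_lim_field Yi Y ->
    forall m, W m -> forall i, N W X Y m i = D i (Wi i) (Xi i) (Yi i) (m i).

Definition lim_conn_components (D : forall i, nabla_op (Mi i)) (c : lchart M)
    (G : F -> H2 M) : Prop :=
  exists2 Gi, forall i, conn_components (D i) (c i) (Gi i) &
    is_lim_gamma c Gi G.

Definition is_lim_connection (N : lnabla_op) (D : forall i, nabla_op (Mi i)) :=
  [/\ forall i, is_connection (D i),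
      is_lim_nabla N D
    & forall c, exists G, lim_conn_components D c G].

Record lconnection := LConnection {
  nabla :> lnabla_op;
  nablaP : exists D, is_lim_connection nabla D
}.

(* G is the local component Gamma_phi of nabla in the chart c.  The operator
   nabla on M only determines the restriction of G x i to the vectors u i with
   u in F. *)
Definition components (N : lconnection) (c : lchart M) (G : F -> H2 M) :=
  exists2 D, is_lim_connection N D & lim_conn_components D c G.

(* The spray assigned to nabla depends on the symmetric part of Gamma only.  As
   nabla acts on vector fields of M, symmetry is tested on F. *)
Definition torsion_free (N : lconnection) : Prop :=
  forall c G, components N c G -> forall m, ldom c m ->
    forall x, at_point c m x ->
    forall (u v : F) i, G x i (u i) (v i) = G x i (v i) (u i).

Definition is_lim_spray (Z : TM -> TTM)
    (z : forall i, tangent (CMi i) -> tangent (Tan (CMi i))) : Prop :=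
  [/\ forall i, is_spray (z i),
      forall v i, Z v i = z i (v i)
    & forall c : lchart M, exists Gi (G : F -> H2 M),
        (forall i, spray_components (z i) (c i) (Gi i)) /\ is_lim_gamma c Gi G].

Record lspray := LSpray {
  zeta :> TM -> TTM;
  zetaP : exists z, is_lim_spray zeta z
}.

Definition assigned (N : lconnection) (Z : lspray) : Prop :=
  forall c G, components N c G -> forall v : TM, ldom c (lfoot v) ->
    forall x, at_point c (lfoot v) x ->
    forall i, rep (Z v i) (c i) =
      (rep (v i) (c i), G x i (rep (v i) (c i)) (rep (v i) (c i))).

(* The topology of M being the limit topology, a curve in M is smooth when its
   components are. *)
Definition smooth_lcurve (J : set R) (g : R -> LM M) : Prop :=
  forall i, smooth_curve J (fun t => g t i).

(* V is the lift T g of g to TM, on J. *)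
Definition is_tangent_curve (J : set R) (g : R -> LM M) (V : R -> TM) : Prop :=
  forall t, J t -> forall i,
    velocity (A := CMi i) (fun s => g s i) t (V t i).

(* The left-hand side of the equation is the local principal part of
   nabla_{Tg} Tg. *)
Definition geodesic (N : lconnection) (J : set R) (g : R -> LM M) : Prop :=
  exists2 V, is_tangent_curve J g V &
    forall c G, components N c G -> forall t, J t -> ldom c (g t) ->
    forall x, at_point c (g t) x -> forall i,
      derive1 (fun s => rep (V s i) (c i)) t
      - G x i (rep (V t i) (c i)) (rep (V t i) (c i)) = 0.

(* T g is an integral curve of zeta. *)
Definition geodesic_spray (Z : lspray) (J : set R) (g : R -> LM M) : Prop :=
  exists2 V, is_tangent_curve J g V &
    forall t, J t -> forall i,
      velocity (A := Tan (CMi i)) (fun s => V s i) t (Z (V t) i).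

End LimitLevel.

(* Main.v *)
Require Import Defs.
From HB Require Import structures.
From mathcomp Require Import all_boot all_order all_algebra.
From mathcomp Require Import all_classical all_reals all_analysis.
From mathcomp Require Import ring lra.
Set Implicit Arguments.
Unset Strict Implicit.
Unset Printing Implicit Defensive.
Import Order.TTheory GRing.Theory Num.Theory numFieldNormedType.Exports.
Local Open Scope classical_set_scope.
Local Open Scope ring_scope.

(** The operator nabla determines its Christoffel symbols on pairs of vectors of
    F, because every such pair extends to constant vector fields on a limit
    chart, on which nabla reduces to minus the symbol
    ([lim_conn_components_unique]).  So it makes sense to ask for a spray with
    local expression (v, G(v, v)), and such a spray is unique.

    At each Banach level, Christoffel symbols transform by
    G_d(T'u, T'v) = T''(u, v) + T' G_c(u, v) under a transition map T
    ([conn_components_trans]).  On the diagonal this is exactly the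
    transformation rule of second order vectors (v, w) in TTM, which gives the
    spray of a connection ([connection_spray]).  Conversely the diagonal law
    polarizes to the full one, since the symbols of a spray are symmetric and
    so is T'' ([spray_components_trans], [second_derivative_sym]); the
    covariant derivative defined by these symbols is then independent of the
    chart ([spray_connection]).

    In a limit chart the bonding maps of M, TM and TTM are the linear maps rho
    ([graph_Tbond], [graph_TTbond]), which commute with the symbols, so that the
    constructions at the Banach levels have limits ([limit_spray],
    [limit_connection]).  For nabla_X Y one point needs care.  The field Y fixes
    its approximations Y_i only on the projection of its domain to M_i.  This
    suffices for their derivatives in the direction X: X takes its values in F,
    and as chart images are open in F, a short segment in that direction lifts
    to M ([near_line], [diff_lim_field_unique]).

    Finally a torsion free connection is recovered from its spray by
    polarization on F ([torsion_free_connection_unique]), and in a limit chart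
    the geodesic equation is the equation of an integral curve of the spray
    ([geodesic_is_geodesic_spray]). *)

(** * Differentials and continuous linear maps *)

Section Differentials.
Context {R : realType}.
Implicit Types E F G : normedModType R.

(** Charts give local formulas only, so differentials are always computed from
    identities that hold near a point. *)
Lemma near_is_diff E F (f g df : E -> F) (x : E) :
  {near x, f =1 g} -> is_diff x f df -> is_diff x g df.
Proof.
move=> fg [dfx dfE]; have [cdf /eqaddoP fo] := (diff_locallyP _ _).1 dfx.
have go : g \o shift x = cst (g x) + 'd f x +o_ (0 : E) id.
  apply/eqaddoP => e e0.
  have fg0 : \forall h \near (0 : E), f (x + h) = g (x + h).
    exact: (nbhs0P (fun y => f y = g y) x).1.
  near=> h.
  have : `|(f \o shift x - (cst (f x) + 'd f x)) h| <= e * `|h|.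
    by near: h; exact: fo.
  by rewrite !fctE /= (nbhs_singleton fg) [h + x]addrC (near fg0 h).
have gE := diff_unique cdf go.
by split; [apply/diff_locallyP; rewrite gE|rewrite gE].
Unshelve. all: by end_near. Qed.

Lemma is_diff_unique E F (f df dg : E -> F) (x : E) :
  is_diff x f df -> is_diff x f dg -> df = dg.
Proof. by move=> [_ <-] [_ <-]. Qed.

Lemma is_diff_differentiable E F (f df : E -> F) (x : E) :
  is_diff x f df -> differentiable f x.
Proof. by case. Qed.

Lemma linear_is_diff E F (f : E -> F) (x : E) :
  linear f -> continuous f -> is_diff x f f.
Proof.
move=> lf cf; pose h := GRing.isLinear.Build R E F *:%R f lf.
pose L : {linear E -> F} := HB.pack f h.
by split; [exact: (@linear_differentiable _ _ _ L)|exact: (@diff_lin _ _ _ L)].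
Qed.

Lemma is_diff_fst E F (p : E * F) : is_diff p fst fst.
Proof. by apply: linear_is_diff => // ?; exact: cvg_fst. Qed.

Lemma is_diff_snd E F (p : E * F) : is_diff p snd snd.
Proof. by apply: linear_is_diff => // ?; exact: cvg_snd. Qed.

Section ContinuousLinearMaps.
Context {E F : normedModType R}.
Implicit Type f : clin E F.

HB.instance Definition _ f :=
  GRing.isLinear.Build R E F *:%R (clin_fun f) (clinP f).1.

Lemma clin_continuous f : continuous f. Proof. exact: (clinP f).2. Qed.

Lemma clin_is_diff f x : is_diff x f f.
Proof. by apply: linear_is_diff; [exact: (clinP f).1|exact: clin_continuous]. Qed.

Lemma clinB f x y : f (x - y) = f x - f y. Proof. exact: linearB. Qed.
Lemma clinD f x y : f (x + y) = f x + f y. Proof. exact: linearD. Qed.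
Lemma clinZ f a x : f (a *: x) = a *: f x. Proof. exact: linearZ. Qed.

Lemma clinDE f g x : (f + g) x = f x + g x. Proof. by []. Qed.
Lemma clinZE a f x : (a *: f) x = a *: f x. Proof. by []. Qed.

Lemma le_clin_norm f x : `|f x| <= `|f| * `|x|.
Proof.
have [->|x0] := eqVneq x 0; first by rewrite linear0 !normr0 mulr0.
have := @le_opnorm _ _ _ f (`|x|^-1 *: x).
rewrite normrZ normfV normr_id mulVf ?normr_eq0// lexx => /(_ isT).
by rewrite linearZ/= normrZ normfV normr_id ler_pdivrMl ?normr_gt0// mulrC.
Qed.

Lemma clin_norm_le f (k : R) : 0 <= k ->
  (forall x, `|f x| <= k * `|x|) -> `|f| <= k.
Proof.
move=> k0 fk; apply: ge_sup; first by exists `|f 0|, 0 => //=; rewrite normr0.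
by move=> _ [x /= x1 <-]; rewrite (le_trans (fk x))// ler_piMr.
Qed.

Lemma bounded_clin (f : E -> F) (k : R) : linear f ->
  (forall x, `|f x| <= k * `|x|) -> f \in @clin_pred R E F.
Proof.
move=> lf fk; rewrite inE; split=> //.
pose h := GRing.isLinear.Build R E F *:%R f lf.
pose L : {linear E -> F} := HB.pack f h.
suff : continuous L by [].
apply: bounded_linear_continuous; apply/linear_boundedP.
near=> r => x; apply: (le_trans (fk x)); rewrite ler_wpM2r//.
Unshelve. all: by end_near. Qed.

Definition mkclin (f : E -> F) (k : R) (lf : linear f)
  (fk : forall x, `|f x| <= k * `|x|) : clin E F := Clin (bounded_clin lf fk).

(** Evaluation is named so that it can carry the structure of a bilinear map,
    whose differential is the product rule for (A, v) |-> A v. *)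
Definition clin_app (f : clin E F) (x : E) : F := f x.

Lemma clin_app_bilinear : bilinear_for
  (GRing.Scale.Law.clone _ _ *:%R _) (GRing.Scale.Law.clone _ _ *:%R _) clin_app.
Proof.
by split=> [u'|u] a x y; rewrite /clin_app //= linearP.
Qed.
HB.instance Definition _ := bilinear_isBilinear.Build R (clin E F) E F _ _
  clin_app clin_app_bilinear.

Lemma clin_app_continuous :
  continuous (fun p : clin E F * E => clin_app p.1 p.2).
Proof.
move=> [A v]; apply/cvgrPdist_lt => /= e e0; rewrite /clin_app/=.
(* k is the sum of the weights with which the two distances enter below. *)
have [k kE] : exists k, k = `|v| + 1 + `|A| + 1 by eexists.
have k0 : 0 < k by rewrite kE ltr_wpDl// !addr_ge0.
near=> p.
rewrite (_ : A v - _ = (A - p.1) v + (p.1 - A) (v - p.2) + A (v - p.2)); last first.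
  have -> : (p.1 - A) (v - p.2) = (p.1 v - p.1 p.2) - (A v - A p.2).
    have pE w : (p.1 - A) w = p.1 w - A w by [].
    by rewrite clinB !pE opprD addrACA -opprD.
  have -> : A (v - p.2) = A v - A p.2 by exact: clinB.
  have -> : (A - p.1) v = A v - p.1 v by [].
  by rewrite -[RHS]addrA subrK addrA subrK.
have p1 : `|A - p.1| < Num.min 1 (e / k).
  near: p; have : p.1 @[p --> nbhs (A, v)] --> A by exact: cvg_fst.
  by move/cvgrPdist_lt; apply; rewrite lt_min ltr01 divr_gt0.
have p2 : `|v - p.2| < e / k.
  near: p; have : p.2 @[p --> nbhs (A, v)] --> v by exact: cvg_snd.
  by move/cvgrPdist_lt; apply; rewrite divr_gt0.
have [p1a p1b] : `|A - p.1| < 1 /\ `|A - p.1| < e / k.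
  by move: p1; rewrite lt_min => /andP[].
rewrite (le_lt_trans (ler_normD _ _))//.
have h1 := le_clin_norm (A - p.1) v.
have h2 := le_clin_norm (p.1 - A) (v - p.2).
have h3 := le_clin_norm A (v - p.2).
rewrite [`|p.1 - A|]distrC in h2.
have -> : e = `|v| * (e / k) + 1 * (e/k) + `|A| * (e / k) + e / k.
  by rewrite -[LHS](@divfK _ k) ?gt_eqF// [in X in _ * X]kE; ring.
have h4 := ler_normD ((A - p.1) v) ((p.1 - A) (v - p.2)).
have h5 : `|A - p.1| * `|v| <= `|v| * (e / k) by rewrite mulrC ler_wpM2l// ltW.
have h6 : `|A - p.1| * `|v - p.2| <= 1 * (e / k) by rewrite ler_pM// ltW.
have h7 : `|A| * `|v - p.2| <= `|A| * (e / k) by rewrite ler_wpM2l// ltW.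
have ek : 0 < e / k by rewrite divr_gt0.
lra.
Unshelve. all: by end_near. Qed.

Lemma is_diff_clin_app (p : clin E F * E) :
  is_diff p (fun q => q.1 q.2) (fun q => p.1 q.2 + q.1 p.2).
Proof.
split; first exact: (differentiable_bilin _ clin_app_continuous).
exact: (diff_bilin _ clin_app_continuous).
Qed.

End ContinuousLinearMaps.
End Differentials.

(** * Smooth maps and second derivatives *)

Section Smooth.
Context {R : realType}.
Implicit Types E F G : normedModType R.

Lemma DerivE E F (f : E -> F) (x : E) :
  differentiable f x -> Deriv f x = 'd f x :> (E -> F).
Proof.
move=> dfx; apply: insubdK; rewrite inE; split; last exact: diff_continuous.
exact: linearP.
Qed.

Lemma differentiable_Deriv E F (f : E -> F) (x : E) :
  differentiable f x -> is_diff x f (Deriv f x).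
Proof. by move=> dfx; split=> //; rewrite DerivE. Qed.

Lemma is_diff_Deriv E F (f : E -> F) (A : clin E F) (x : E) :
  is_diff x f A -> Deriv f x = A.
Proof. by move=> [dfx dfE]; apply/val_inj; rewrite /= DerivE. Qed.

Lemma near_Deriv E F (f g : E -> F) (x : E) :
  {near x, f =1 g} -> differentiable f x -> Deriv g x = Deriv f x.
Proof.
move=> fg dfx; apply: is_diff_Deriv; apply: near_is_diff fg _.
exact: differentiable_Deriv.
Qed.

Lemma near_continuous E F (f g : E -> F) (x : E) :
  {near x, f =1 g} -> {for x, continuous f} -> {for x, continuous g}.
Proof.
move=> fg cf; rewrite /prop_for/continuous_at -(nbhs_singleton fg).
by apply: cvg_trans cf; exact: near_eq_cvg.
Qed.

(** Openness of S makes the derivatives of f and g agree on S as well, which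
    is what the induction on the order needs. *)
Lemma Ck_on_eq E F n (S : set E) (f g : E -> F) :
  open S -> (forall x, S x -> f x = g x) -> Ck_on n S f -> Ck_on n S g.
Proof.
move=> oS; elim: n F f g => [|n IHn] F f g fg /=.
  move=> cf x Sx; apply: near_continuous (cf x Sx).
  by apply: filterS (open_nbhs_nbhs (conj oS Sx)).
move=> [df Cf].
have near_fg x : S x -> {near x, f =1 g}.
  by move=> Sx; apply: filterS (open_nbhs_nbhs (conj oS Sx)).
split=> [x Sx|].
  apply: is_diff_differentiable; apply: near_is_diff (near_fg x Sx) _.
  exact/differentiable_Deriv/df.
by apply: IHn Cf => x Sx; apply/esym/near_Deriv; [exact: near_fg|exact: df].
Qed.

Lemma Ck_on_subset E F n (S T : set E) (f : E -> F) :
  T `<=` S -> Ck_on n S f -> Ck_on n T f.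
Proof.
move=> TS; elim: n F f => [|n IHn] F f /= => [cf x /TS/cf//|[df Cf]].
by split=> [x /TS/df//|]; exact: IHn.
Qed.

Lemma is_diff_clin_comp E F G (L : clin F G) (f df : E -> F) (x : E) :
  is_diff x f df -> is_diff x (L \o f) (L \o df).
Proof. by move=> dfx; apply: is_diff_comp dfx _; exact: clin_is_diff. Qed.

Section Postcomposition.
Context {E F G : normedModType R} (L : clin F G).

Lemma postcomp_subproof (A : clin E F) :
  linear (L \o A) /\ forall x, `|(L \o A) x| <= (`|L| * `|A|) * `|x|.
Proof.
split=> [a x y|x] /=; first by rewrite clinD clinZ clinD clinZ.
by rewrite (le_trans (le_clin_norm _ _))// -mulrA ler_wpM2l// le_clin_norm.
Qed.

Definition postcomp1 (A : clin E F) : clin E G :=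
  mkclin (postcomp_subproof A).1 (postcomp_subproof A).2.

Lemma postcomp_linear : linear postcomp1.
Proof. by move=> a A B; apply/val_inj/funext => x /=; rewrite clinD clinZ. Qed.

Lemma postcomp_bounded A : `|postcomp1 A| <= `|L| * `|A|.
Proof.
by apply: clin_norm_le => [|x]; [rewrite mulr_ge0|exact: (postcomp_subproof A).2].
Qed.

(** Composition with L as a continuous linear map on L(E, F): it turns
    D(L o f) = L o Df into a statement of the same form, one order lower. *)
Definition postcomp : clin (clin E F) (clin E G) :=
  mkclin postcomp_linear postcomp_bounded.

End Postcomposition.

Lemma Ck_on_clin_comp E F G n (S : set E) (L : clin F G) (f : E -> F) :
  open S -> Ck_on n S f -> Ck_on n S (L \o f).
Proof.
move=> oS; elim: n F G L f => [|n IHn] F G L f /=.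
  by move=> cf x Sx; apply: continuous_comp; [exact: cf|exact: clin_continuous].
move=> [df Cf].
have dLf x : S x -> is_diff x (L \o f) (L \o Deriv f x).
  by move=> /df ?; apply: is_diff_clin_comp; exact: differentiable_Deriv.
split=> [x /dLf[]//|].
apply: Ck_on_eq (IHn _ _ (postcomp L) _ Cf) => // x Sx.
by apply/esym/is_diff_Deriv; exact: dLf.
Qed.

Lemma Deriv_cst E F (w : F) (x : E) : Deriv (cst w) x = 0.
Proof. by apply: is_diff_Deriv; exact: is_diff_cst. Qed.

Lemma smooth_on_cst E F (S : set E) (w : F) : smooth_on S (cst w).
Proof.
move=> n; elim: n F w => [|n IHn] F w /=; first by move=> x _; exact: cst_continuous.
split=> [x _|]; first exact: differentiable_cst.
by rewrite (_ : Deriv _ = cst 0) //; apply/funext => x; exact: Deriv_cst.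
Qed.

Lemma smooth_on_Deriv E F (S : set E) (f : E -> F) :
  smooth_on S f -> smooth_on S (Deriv f).
Proof. by move=> sf n; have [] := sf n.+1. Qed.

Lemma smooth_on_differentiable E F (S : set E) (f : E -> F) (x : E) :
  smooth_on S f -> S x -> differentiable f x.
Proof. by move=> /(_ 1%N)[+ _]; apply. Qed.

(** This order of smoothness is what the transformation laws of connections and
    sprays involve. *)
Definition twice_diff E F (f : E -> F) (x : E) : Prop :=
  (\forall y \near x, differentiable f y) /\ differentiable (Deriv f) x.

Lemma smooth_on_twice_diff E F (S : set E) (f : E -> F) (x : E) :
  open S -> smooth_on S f -> S x -> twice_diff f x.
Proof.
move=> oS sf Sx; split.
  apply: filterS (open_nbhs_nbhs (conj oS Sx)) => y.
  exact: smooth_on_differentiable.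
exact: smooth_on_differentiable (smooth_on_Deriv sf) Sx.
Qed.

Lemma twice_differentiable E F (f : E -> F) (x : E) :
  twice_diff f x -> differentiable f x.
Proof. by move=> [/nbhs_singleton]. Qed.

Lemma is_diff_ext E F (f df dg : E -> F) (x : E) :
  is_diff x f df -> df =1 dg -> is_diff x f dg.
Proof. by move=> fx /funext <-. Qed.

Lemma near_fst E F (P : set E) (x : E) (v : F) :
  (\forall y \near x, P y) -> \forall p \near (x, v), P p.1.
Proof. by move=> Px; exact: (@cvg_fst E F (nbhs x) (nbhs v) _ P Px). Qed.

(** The product rule for (x, v) |-> (f x, f'(x) v). *)
Lemma is_diff_Tmap E F (f : E -> F) (x v : E) : twice_diff f x ->
  is_diff (x, v) (Tmap f)
    (fun h => ('d f x h.1, 'd (Deriv f) x h.1 v + 'd f x h.2)).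
Proof.
move=> [df ddf]; have dfx := nbhs_singleton df.
have d1 : is_diff (x, v) (fun p : E * E => f p.1) (fun h => Deriv f x h.1).
  apply: (@is_diff_comp _ _ _ _ fst fst f) => /=; first exact: is_diff_fst.
  exact: differentiable_Deriv.
have d2 : is_diff (x, v) (fun p : E * E => (Deriv f p.1, p.2))
    (fun h => (Deriv (Deriv f) x h.1, h.2)).
  apply: is_diff_pair; last exact: is_diff_snd.
  apply: (@is_diff_comp _ _ _ _ fst fst (Deriv f)) => /=; first exact: is_diff_fst.
  exact: differentiable_Deriv.
have d3 : is_diff (x, v) (fun p : E * E => Deriv f p.1 p.2)
    (fun h => Deriv f x h.2 + Deriv (Deriv f) x h.1 v).
  exact: is_diff_comp d2 (is_diff_clin_app _).
apply: (@near_is_diff _ _ _ (fun p : E * E => (f p.1, Deriv f p.1 p.2))).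
  have : \forall p \near (x, v), differentiable f p.1.
    exact: near_fst df.
  by apply: filterS => p dfp; rewrite /Tmap DerivE.
apply: is_diff_ext (is_diff_pair d1 d3) _ => h /=.
by rewrite addrC !DerivE.
Qed.

Lemma Tmap_comp E F G (f : E -> F) (g : F -> G) (p : E * E) :
  differentiable f p.1 -> differentiable g (f p.1) ->
  Tmap (g \o f) p = Tmap g (Tmap f p).
Proof. by move=> df dg; rewrite /Tmap/= diff_comp. Qed.

Lemma near_Tmap E F (f g : E -> F) (x v : E) :
  {near x, f =1 g} -> (\forall y \near x, differentiable f y) ->
  {near (x, v), Tmap f =1 Tmap g}.
Proof.
move=> fg df; have fg2 := near_join fg.
have fgd : \forall y \near x, f y = g y /\ 'd f y = 'd g y :> (E -> F).
  near=> y.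
  have fgy : {near y, f =1 g} by near: y.
  have dfy : differentiable f y by near: y.
  split; first exact: nbhs_singleton fgy.
  by have [_ ->] := near_is_diff fgy (differentiable_Deriv dfy); rewrite DerivE.
by have := near_fst v fgd; apply: filterS => p [/= fgp dfgp]; rewrite /Tmap fgp dfgp.
Unshelve. all: by end_near. Qed.

(** It suffices to obtain every bound K larger than C.  The function
    s |-> |g 1 - g s| + K s then increases to the right of each point of
    [0, 1[, so that it takes its maximum at 1. *)
Lemma mean_value_inequality F (g : R -> F) (dg : R -> R -> F) (C : R) :
  (forall s : R, 0 <= s <= 1 -> is_diff s g (dg s)) ->
  (forall s : R, 0 <= s <= 1 -> `|dg s 1| <= C) -> `|g 1 - g 0| <= C.
Proof.
move=> gd dgC; apply/ler_addgt0Pr => e e0.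
pose psi s := `|g 1 - g s| + (C + e) * s.
have cpsi : {within `[0, 1], continuous psi}.
  apply: continuous_in_subspaceT => s /set_mem; rewrite /= in_itv/= => s01.
  apply: cvgD; last by apply: cvgM; [exact: cvg_cst|exact: cvg_id].
  apply: cvg_norm; apply: cvgB; first exact: cvg_cst.
  by apply: differentiable_continuous; case: (gd s s01).
have [c] := EVT_max (@ler01 R) cpsi; rewrite in_itv/= => /andP[c0 c1] cmax.
have psi0 : psi 0 <= psi c by apply: cmax; rewrite in_itv/= lexx ler01.
have [c_lt1|c_ge1] := ltP c 1; last first.
  have c1E : c = 1 by apply/eqP; rewrite eq_le c1.
  by move: psi0; rewrite /psi c1E subrr normr0 mulr0 mulr1 addr0 add0r.
exfalso.
have [dgc dgE] := gd c (introT andP (conj c0 c1)).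
have [_ /eqaddoP go] := (diff_locallyP _ _).1 dgc.
have e20 : 0 < e / 2 by rewrite divr_gt0.
have /nbhs_ballP[d /= d0 dP] := go _ e20.
(* The step h is small enough for the first order expansion of g at c, whose
   error is at most e h / 2, and keeps c + h in [0, 1]. *)
pose h := Num.min (d / 2) (1 - c).
have h0 : 0 < h by rewrite lt_min divr_gt0// subr_gt0.
have hd : h < d by rewrite (@le_lt_trans _ _ (d / 2)) ?ge_min ?lexx//; lra.
have hc : h <= 1 - c by rewrite ge_min lexx orbT.
have := dP h; rewrite -ball_normE /= sub0r normrN gtr0_norm// => /(_ hd).
rewrite !fctE /= dgE => gh.
have := cmax (h + c); rewrite in_itv/= => /(_ _)/wrap[]; first by apply/andP; split; lra.
rewrite /psi leNgt => /negP; apply.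
have dgh : `|dg c h| <= C * h.
  have DgE : Deriv g c = dg c :> (R -> F) by rewrite DerivE.
  have -> : dg c h = h *: dg c 1.
    by rewrite -DgE -clinZ; congr (Deriv g c _); rewrite /GRing.scale/= mulr1.
  by rewrite normrZ gtr0_norm// mulrC ler_wpM2r ?(ltW h0)// dgC// c0 c1.
have t1 : `|g 1 - g c| <=
    `|g 1 - g (h + c)| + `|g (h + c) - (g c + dg c h)| + `|dg c h|.
  rewrite -[g 1 - g c](subrKA (g (h + c))).
  rewrite -[leRHS]addrA (le_trans (ler_normD _ _))// lerD2l.
  rewrite (_ : g (h + c) - g c = (g (h + c) - (g c + dg c h)) + dg c h) ?ler_normD//.
  by rewrite opprD addrA subrK.
have eh : 0 < e / 2 * h by rewrite mulr_gt0.
rewrite mulrDr; nra.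
Qed.

End Smooth.

Section SecondDerivative.
Context {R : realType}.
Implicit Types E F G : normedModType R.

Fact second_difference_identity (V : zmodType) (b c d p q : V) :
  b - d - (p + q) - (c - d - p) = b - c - q.
Proof.
have -> : b - d - (p + q) = b - d - q - p by rewrite [p + q]addrC opprD addrA.
by rewrite opprB subrKA [LHS]addrAC opprB subrKA.
Qed.

Fact second_difference_sym (V : zmodType) (p a b c : V) :
  p - a - (b - c) = p - b - (a - c).
Proof.
by rewrite !opprB !addrA [p - a + c]addrAC [p - b + c]addrAC [LHS]addrAC.
Qed.

Lemma is_diff_line E (v w : E) (s : R) :
  is_diff s (fun t : R => t *: v + w) (fun h : R => h *: v).
Proof.
have d1 : is_diff s (fun t : R => t *: v) (fun h : R => h *: v).
  exact: is_diff_scalel.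
have d2 := is_diffD d1 (is_diff_cst w s).
by apply: is_diff_ext d2 _ => h; rewrite !fctE addr0.
Qed.

(** The mean value inequality is applied on [0, 1] to
    s |-> f(x + u + s v) - f(x + s v) - s f''(x)(u, v); its derivative is the
    difference of two first order errors of f' at x. *)
Lemma second_difference_estimate E F (f : E -> F) (x u v : E) (eps : R) :
  0 <= eps ->
  (forall h, `|h| <= `|u| + `|v| -> differentiable f (h + x) /\
    `|Deriv f (h + x) - Deriv f x - Deriv (Deriv f) x h| <= eps * `|h|) ->
  `|f (v + (u + x)) - f (v + x) - (f (u + x) - f x) - Deriv (Deriv f) x u v|
    <= 2 * eps * (`|u| + `|v|) ^+ 2.
Proof.
move=> eps0 fP; set A := Deriv (Deriv f) x; set N := `|u| + `|v|.
have N0 : 0 <= N by rewrite addr_ge0.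
pose g s := f (s *: v + (u + x)) - f (s *: v + x) - s *: A u v.
have nsv (s : R) : 0 <= s <= 1 -> `|s *: v| <= N.
  move=> /andP[s0 s1]; rewrite normrZ ger0_norm// /N.
  by rewrite (@le_trans _ _ `|v|) ?ler_wnDl ?lerDr// ler_piMl.
have nsvu (s : R) : 0 <= s <= 1 -> `|s *: v + u| <= N.
  move=> /andP[s0 s1]; rewrite (le_trans (ler_normD _ _))// addrC lerD2l.
  by rewrite normrZ ger0_norm// ler_piMl.
pose dg (s h : R) := Deriv f (s *: v + (u + x)) (h *: v)
  - Deriv f (s *: v + x) (h *: v) - h *: A u v.
have gd (s : R) : 0 <= s <= 1 -> is_diff s g (dg s).
  move=> s01.
  have d1 : is_diff s (fun t : R => f (t *: v + (u + x)))
      (fun h => Deriv f (s *: v + (u + x)) (h *: v)).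
    apply: (is_diff_comp (is_diff_line v (u + x) s)).
    by apply: differentiable_Deriv; rewrite addrA; exact: (fP _ (nsvu s s01)).1.
  have d2 : is_diff s (fun t : R => f (t *: v + x))
      (fun h => Deriv f (s *: v + x) (h *: v)).
    apply: (is_diff_comp (is_diff_line v x s)).
    by apply: differentiable_Deriv; exact: (fP _ (nsv s s01)).1.
  have d3 : is_diff s (fun t : R => t *: A u v) (fun h => h *: A u v).
    exact: is_diff_scalel.
  exact: is_diffB (is_diffB d1 d2) d3.
have dgC (s : R) : 0 <= s <= 1 -> `|dg s 1| <= 2 * eps * N ^+ 2.
  move=> s01.
  have -> : dg s 1 = (Deriv f (s *: v + u + x) - Deriv f x - A (s *: v + u)
                     - (Deriv f (s *: v + x) - Deriv f x - A (s *: v))) v.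
    rewrite /dg !scale1r addrA.
    set B := Deriv f _; set C := Deriv f _; set D := Deriv f x.
    by rewrite clinD second_difference_identity.
  rewrite (le_trans (le_clin_norm _ _))//.
  have vN : `|v| <= N by rewrite lerDr.
  have -> : 2 * eps * N ^+ 2 = (eps * N + eps * N) * N by ring.
  rewrite ler_pM// (le_trans (ler_normB _ _))// lerD//.
    rewrite (le_trans (fP _ (nsvu s s01)).2)// ler_wpM2l//; exact: nsvu.
  rewrite (le_trans (fP _ (nsv s s01)).2)// ler_wpM2l//; exact: nsv.
have := mean_value_inequality gd dgC.
rewrite /g !scale1r !scale0r !add0r subr0.
rewrite (_ : f (v + (u + x)) - f (v + x) - A u v - _ =
  f (v + (u + x)) - f (v + x) - (f (u + x) - f x) - A u v)//.
by rewrite addrAC.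
Qed.

(** The second difference f(x + u + v) - f(x + v) - f(x + u) + f(x) is symmetric
    in u and v.  At scale t it approximates both t^2 f''(x)(u, v) and
    t^2 f''(x)(v, u) up to o(t^2). *)
Lemma second_derivative_sym E F (f : E -> F) (x u v : E) : twice_diff f x ->
  Deriv (Deriv f) x u v = Deriv (Deriv f) x v u.
Proof.
move=> [df ddf]; set A := Deriv (Deriv f) x; apply/eqP; rewrite -subr_eq0.
rewrite -normr_eq0 eq_le normr_ge0 andbT; apply/ler_addgt0Pr => e e0; rewrite add0r.
pose N := `|u| + `|v| + 1.
have N0 : 0 < N by rewrite ltr_wpDl// addr_ge0.
(* With this eps the two errors 2 eps (t (|u| + |v|))^2 add up to at most
   t^2 e. *)
pose eps := e / (4 * N ^+ 2).
have N20 : 0 < N ^+ 2 by rewrite exprn_gt0.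
have eps0 : 0 < eps by rewrite divr_gt0// mulr_gt0.
have dD : is_diff x (Deriv f) A by exact: differentiable_Deriv.
have [_ /eqaddoP go] := (diff_locallyP _ _).1 ddf.
have df0 : \forall h \near (0 : E), differentiable f (x + h).
  exact: (nbhs0P (fun y => differentiable f y) x).1.
have : \forall h \near (0 : E), differentiable f (h + x) /\
    `|Deriv f (h + x) - Deriv f x - A h| <= eps * `|h|.
  near=> h; split; first by rewrite addrC; near: h.
  rewrite -addrA -opprD.
  have : `|(Deriv f \o shift x - (cst (Deriv f x) + 'd (Deriv f) x)) h| <= eps * `|h|.
    by near: h; exact: go.
  by rewrite /A !fctE /= DerivE.
move=> /nbhs_ballP[d /= d0 dP].
have [t tE] : exists t, t = d / (2 * N) by eexists.
have t0 : 0 < t by rewrite tE divr_gt0// mulr_gt0.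
have HP h : `|h| <= t * (`|u| + `|v|) -> differentiable f (h + x) /\
    `|Deriv f (h + x) - Deriv f x - A h| <= eps * `|h|.
  move=> ht; apply: dP; rewrite -ball_normE /= sub0r normrN (le_lt_trans ht)//.
  rewrite (@lt_trans _ _ (t * N)) ?ltr_pM2l ?ltrDl//.
  rewrite (_ : t * N = d / 2); first by lra.
  by rewrite tE invfM mulrA mulfVK ?gt_eqF.
have tuv : `|t *: u| + `|t *: v| = t * (`|u| + `|v|).
  by rewrite !normrZ (gtr0_norm t0) mulrDr.
have tvu : `|t *: v| + `|t *: u| = t * (`|u| + `|v|) by rewrite addrC.
have h1 := @second_difference_estimate _ _ f x (t *: u) (t *: v) eps (ltW eps0).
rewrite tuv in h1; have {}h1 := h1 HP.
have h2 := @second_difference_estimate _ _ f x (t *: v) (t *: u) eps (ltW eps0).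
rewrite tvu in h2; have {}h2 := h2 HP.
have AE a b : A (t *: a) (t *: b) = t ^+ 2 *: A a b.
  by rewrite !clinZ clinZE scalerA expr2.
rewrite !AE in h1 h2.
have DE : f (t *: v + (t *: u + x)) - f (t *: v + x) - (f (t *: u + x) - f x) =
  f (t *: u + (t *: v + x)) - f (t *: u + x) - (f (t *: v + x) - f x).
  by rewrite [in LHS]addrCA second_difference_sym.
move: h1 h2; rewrite DE; set D := (X in `|X - _| <= _) => h1 h2.
have : `|t ^+ 2 *: (A u v - A v u)| <= t ^+ 2 * e.
  rewrite scalerBr.
  have -> : t ^+ 2 *: A u v - t ^+ 2 *: A v u =
      (D - t ^+ 2 *: A v u) - (D - t ^+ 2 *: A u v).
    by rewrite opprB [RHS]addrC subrKA.
  rewrite (le_trans (ler_normB _ _))// (le_trans (lerD h2 h1))//.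
  rewrite -mulrDl.
  have -> : (2 * eps + 2 * eps) * (t * (`|u| + `|v|)) ^+ 2 =
     (t ^+ 2) * (4 * (`|u| + `|v|) ^+ 2 * eps) by ring.
  rewrite ler_wpM2l ?sqr_ge0// /eps mulrA ler_pdivrMr ?mulr_gt0//.
  rewrite mulrC (ler_pM2l e0) ler_pM2l// ler_sqr ?nnegrE ?addr_ge0//.
  by rewrite lerDl.
by rewrite normrZ ger0_norm ?sqr_ge0// ler_pM2l// exprn_gt0.
Unshelve. all: by end_near. Qed.

End SecondDerivative.

(** * Tangent vectors, tangent maps and velocities in charts *)

Section Tangent.
Context {R : realType}.
Implicit Types A B : coords R.

Lemma tangent_ext A (v w : tangent A) :
  foot v = foot w -> rep v =1 rep w -> v = w.
Proof.
case: v w => [m f fP fO] [m' g gP gO] /= mm' /funext fg.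
move: fP fO gP gO; rewrite -mm' -fg => fP fO gP gO.
by rewrite (Prop_irrelevance fP gP) (Prop_irrelevance fO gO).
Qed.

Lemma tangent_eq_in_chart A (v w : tangent A) (i : idx A) :
  foot v = foot w -> dom i (foot v) -> rep v i = rep w i -> v = w.
Proof.
move=> fvw di rvw; apply: tangent_ext => // j.
have [dj|ndj] := pselect (dom j (foot v)).
  rewrite (rep_trans di dj) rvw (_ : loc i (foot v) = loc i (foot w)) ?fvw//.
  by rewrite -rep_trans// -fvw.
by rewrite rep_out// rep_out// -fvw.
Qed.

Lemma near_preimage (T U : topologicalType) (f : T -> U) (x : T) (y : U)
  (P : set U) : {for x, continuous f} -> f x = y -> (\forall z \near y, P z) ->
  \forall z \near x, P (f z).
Proof. by move=> cf <- /cf. Qed.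

Lemma rep_trans_at A (w : tangent A) m i j : foot w = m -> dom i m -> dom j m ->
  rep w j = 'd (trans i j) (loc i m) (rep w i).
Proof. by move=> <-; exact: rep_trans. Qed.

(** A tangent vector given by its representatives in the charts at m; the
    encoding asks for the value 0 in the other charts. *)
Section Glue.
Context {A : coords R} {m : pt A} {f : idx A -> mdl A}.
Hypothesis fP : forall i j, dom i m -> dom j m ->
  f j = 'd (trans i j) (loc i m) (f i).

Let g i : mdl A := if pselect (dom i m) then f i else 0.

Let g_trans i j : dom i m -> dom j m ->
  g j = 'd (trans i j) (loc i m) (g i).
Proof.
by move=> di dj; rewrite /g; do 2![case: pselect => //=] => *; exact: fP.
Qed.

Let g_out i : ~ dom i m -> g i = 0.
Proof. by rewrite /g; case: pselect. Qed.

Definition glue_tangent : tangent A := Tangent g_trans g_out.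

Lemma glue_tangentE i : dom i m -> rep glue_tangent i = f i.
Proof. by rewrite /= /g; case: pselect. Qed.

End Glue.

Lemma tangent0_subproof A (m : pt A) i j : dom i m -> dom j m ->
  0 = 'd (trans i j) (loc i m) 0 :> mdl A.
Proof. by rewrite linear0. Qed.

Definition tangent0 A (m : pt A) : tangent A :=
  glue_tangent (@tangent0_subproof A m).

Lemma tangent0E A (m : pt A) i : rep (tangent0 m) i = 0.
Proof. by rewrite /=; case: pselect. Qed.

(** The coherence of the transition maps which makes tangent vectors of A
    determined by, and constructible from, one representative. *)
Definition coherent A : Prop :=
  [/\ forall (i j : idx A) m, dom i m -> dom j m ->
        trans i j (loc i m) = loc j m,
      forall (i j : idx A) m, dom i m -> dom j m ->
        differentiable (trans i j) (loc i m),
      forall (i : idx A) m, dom i m -> \forall x \near loc i m, trans i i x = x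
    & forall (i j k : idx A) m, dom i m -> dom j m -> dom k m ->
        \forall x \near loc i m, trans j k (trans i j x) = trans i k x].

Definition coherent2 A : Prop :=
  coherent A /\
  forall (i j : idx A) m, dom i m -> dom j m -> twice_diff (trans i j) (loc i m).

Section Coherent.
Context {A : coords R} (HA : coherent A).

Lemma trans_loc (i j : idx A) m : dom i m -> dom j m ->
  trans i j (loc i m) = loc j m.
Proof. by case: HA => + _ _ _; apply. Qed.

Lemma trans_diff (i j : idx A) m : dom i m -> dom j m ->
  differentiable (trans i j) (loc i m).
Proof. by case: HA => _ + _ _; apply. Qed.

Lemma trans_cocycle (i j k : idx A) m u : dom i m -> dom j m -> dom k m ->
  'd (trans j k) (loc j m) ('d (trans i j) (loc i m) u) =
  'd (trans i k) (loc i m) u.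
Proof.
move=> di dj dk; have [_ _ _ cc] := HA.
have ijk := near_is_diff (cc i j k m di dj dk)
  (is_diff_comp (differentiableP (trans_diff di dj)) (differentiableP _)).
rewrite -(trans_loc di dj).
have djk : differentiable (trans j k) (trans i j (loc i m)).
  by rewrite trans_loc//; exact: trans_diff.
by have [_ /(congr1 (fun h => h u)) e] := ijk djk; exact: esym e.
Qed.

Lemma trans_id (i : idx A) m u : dom i m -> 'd (trans i i) (loc i m) u = u.
Proof.
move=> di; have [_ _ idi _] := HA.
have h : is_diff (loc i m) (trans i i) id.
  apply: near_is_diff (is_diff_id (loc i m)).
  by apply: filterS (idi i m di) => x ->.
by have [_ ->] := h.
Qed.

Lemma trans_inv (i j : idx A) m u : dom i m -> dom j m ->
  'd (trans j i) (loc j m) ('d (trans i j) (loc i m) u) = u.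
Proof. by move=> di dj; rewrite trans_cocycle// trans_id. Qed.

Lemma tangent_in_subproof (i : idx A) m u : dom i m -> forall j k,
  dom j m -> dom k m -> 'd (trans i k) (loc i m) u =
  'd (trans j k) (loc j m) ('d (trans i j) (loc i m) u).
Proof. by move=> di j k dj dk; rewrite trans_cocycle. Qed.

Definition tangent_in (i : idx A) m u (di : dom i m) : tangent A :=
  glue_tangent (tangent_in_subproof u di).

Lemma tangent_inE (i : idx A) m u (di : dom i m) j : dom j m ->
  rep (tangent_in u di) j = 'd (trans i j) (loc i m) u.
Proof. by move=> dj; rewrite glue_tangentE. Qed.

Lemma tangent_in_self (i : idx A) m u (di : dom i m) :
  rep (tangent_in u di) i = u.
Proof. by rewrite tangent_inE// trans_id. Qed.

End Coherent.

(** The tangent bundle inherits coherence, one order of smoothness being lost;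
    applied to a manifold it makes TTM accessible through one chart. *)
Lemma coherent_Tan A : coherent2 A -> coherent (Tan A).
Proof.
move=> [HA HA2]; split=> [i j v di dj|i j v di dj|i v di|i j k v di dj dk].
- by rewrite /= /Tmap/= trans_loc// -rep_trans.
- by apply: is_diff_differentiable; apply: is_diff_Tmap; exact: HA2.
- have [_ _ idi _] := HA.
  change (idx (Tan A)) with (idx A) in i.
  change (pt (Tan A)) with (tangent A) in v.
  have nT : {near (loc i (foot v), rep v i), Tmap (trans i i) =1 Tmap id}.
    exact: near_Tmap (idi _ _ di) (HA2 _ _ _ di di).1.
  apply: filterS nT => p; rewrite /= => ->.
  by rewrite /Tmap; have [_ ->] := is_diff_id p.1; rewrite -surjective_pairing.
- have [_ _ _ cc] := HA.
  change (idx (Tan A)) with (idx A) in i, j, k.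
  change (pt (Tan A)) with (tangent A) in v.
  have [djk _] := HA2 _ _ _ dj dk.
  have djk' : \forall x \near loc i (foot v),
      differentiable (trans j k) (trans i j x).
    exact: (near_preimage (differentiable_continuous (trans_diff HA di dj))
      (trans_loc HA di dj) djk).
  have dcomp : \forall x \near loc i (foot v),
      differentiable (trans j k \o trans i j) x.
    apply: filterS2 djk' (HA2 _ _ _ di dj).1 => x dx1 dx2.
    exact: differentiable_comp.
  near=> p.
  have -> : @trans _ (Tan A) i k p = Tmap (trans j k \o trans i j) p.
    by apply/esym; near: p; exact: near_Tmap (cc _ _ _ _ di dj dk) dcomp.
  rewrite Tmap_comp//.
    by near: p; exact: near_fst (HA2 _ _ _ di dj).1.
  by near: p; exact: near_fst djk'.
Unshelve. all: by end_near. Qed.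

(** What makes the tangent map of f computable in a single pair of charts. *)
Definition coherent_mor A B (f : cmor A B) : Prop :=
  forall x y, graph f x y -> forall (i : idx A) (j : idx B),
    dom i x -> dom j y ->
  [/\ mloc f i j (loc i x) = loc j y,
      differentiable (mloc f i j) (loc i x)
    & forall (i' : idx A) (j' : idx B), dom i' x -> dom j' y ->
        \forall z \near loc i' x, trans j j' (mloc f i j (trans i' i z)) = mloc f i' j' z].

Definition coherent_mor2 A B (f : cmor A B) : Prop :=
  coherent_mor f /\ forall x y, graph f x y -> forall (i : idx A) (j : idx B),
    dom i x -> dom j y -> twice_diff (mloc f i j) (loc i x).

(** The chain rule carries the relation between representatives from one pair
    of charts to all others. *)
Lemma graph_Tmor A B (f : cmor A B) (v : tangent A) (w : tangent B) i j :
  coherent A -> coherent B -> coherent_mor f ->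
  graph f (foot v) (foot w) -> dom i (foot v) -> dom j (foot w) ->
  rep w j = 'd (mloc f i j) (loc i (foot v)) (rep v i) ->
  graph (Tmor f) v w.
Proof.
move=> HA HB Hf fvw di dj wj; split=> // i' j' di' dj'.
have [fl df cf] := Hf _ _ fvw i j di dj.
have /= fE := near_is_diff (cf i' j' di' dj') (is_diff_comp
  (is_diff_comp (differentiableP (trans_diff HA di' di)) (differentiableP _))
  (differentiableP _)).
rewrite (rep_trans dj dj') wj (rep_trans di' di).
rewrite /= !(trans_loc HA) // in fE.
rewrite fl in fE.
by have [_ ->] := fE df (trans_diff HB dj dj').
Qed.

Lemma coherent_Tmor A B (f : cmor A B) :
  coherent2 A -> coherent2 B -> coherent_mor2 f -> coherent_mor (Tmor f).
Proof.
move=> [HA HA2] [HB HB2] [Hf Hf2] v w [fvw rvw] i j di dj.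
have [fl df cf] := Hf _ _ fvw i j di dj.
have df2 := Hf2 _ _ fvw i j di dj.
split=> [||i' j' di' dj'].
- by rewrite /= /Tmap/= fl -rvw.
- by apply: is_diff_differentiable; exact: is_diff_Tmap.
- change (idx (Tan A)) with (idx A) in i, i'.
  change (idx (Tan B)) with (idx B) in j, j'.
  change (pt (Tan A)) with (tangent A) in v.
  change (pt (Tan B)) with (tangent B) in w.
  have dt := trans_diff HA di' di.
  have e1 : trans i' i (loc i' (foot v)) = loc i (foot v).
    exact: trans_loc.
  have n1 := (HA2 _ _ _ di' di).1.
  have n2 : \forall z \near loc i' (foot v), differentiable (mloc f i j) (trans i' i z).
    exact: (near_preimage (differentiable_continuous dt) e1 df2.1).
  have n3 : \forall z \near loc i' (foot v),
      differentiable (trans j j') (mloc f i j (trans i' i z)).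
    have n3' := near_preimage (differentiable_continuous df) fl (HB2 _ _ _ dj dj').1.
    exact: (near_preimage (differentiable_continuous dt) e1 n3').
  have n12 : \forall z \near loc i' (foot v),
      differentiable (mloc f i j \o trans i' i) z.
    by apply: filterS2 n1 n2 => z ? ?; exact: differentiable_comp.
  have n123 : \forall z \near loc i' (foot v),
      differentiable (trans j j' \o (mloc f i j \o trans i' i)) z.
    by apply: filterS2 n12 n3 => z ? ?; exact: differentiable_comp.
  near=> p.
  have -> : mloc (Tmor f) i' j' p = Tmap (trans j j' \o (mloc f i j \o trans i' i)) p.
    by apply/esym; near: p; exact: near_Tmap (cf _ _ di' dj') n123.
  rewrite Tmap_comp//.
  - rewrite Tmap_comp//; near: p; [exact: near_fst n1|exact: near_fst n2].
  - by near: p; exact: near_fst n12.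
  - by near: p; exact: near_fst n3.
Unshelve. all: by end_near. Qed.

Lemma is_derive1P (E : normedModType R) (f : R -> E) (t : R) (v : E) :
  is_derive t 1 f v <-> is_diff t f (fun h => h *: v).
Proof.
split=> [[df <-]|[df dfE]].
  have df' := (derivable1_diffP f t).1 df.
  by split=> //; rewrite diff1E// derive1E.
split; first exact/derivable1_diffP.
by rewrite deriveE// dfE scale1r.
Qed.

(** By the chain rule, a velocity can be tested in one chart. *)
Lemma velocity_in_chart A (c : R -> pt A) (t : R) (w : tangent A) (i : idx A) :
  coherent A -> foot w = c t -> dom i (c t) ->
  (forall j, dom j (c t) -> \forall s \near t, dom j (c s)) ->
  is_derive t 1 (fun s => loc i (c s)) (rep w i) -> velocity c t w.
Proof.
move=> HA wt di near_dom /is_derive1P dw; split=> // j dj; apply/is_derive1P.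
apply: (@near_is_diff _ _ _ (trans i j \o (fun s => loc i (c s)))).
  apply: filterS2 (near_dom i di) (near_dom j dj) => s ? ?.
  by rewrite /= trans_loc.
have := is_diff_comp dw (differentiableP (trans_diff HA di dj)).
move=> /is_diff_ext; apply => h /=.
by rewrite (rep_trans_at wt di dj) linearZ.
Qed.

End Tangent.

(** * Charts of Banach manifolds *)

Section ChartsAndMaps.
Context {R : realType} {E : completeNormedModType R} (M : banach_manifold E).
Notation A := (coords_of M).

Lemma idx_chart (c : idx A) : is_chart (sval c).
Proof. exact: atlas_chart (svalP c). Qed.

Lemma dom_open (c : idx A) : open (dom c : set M).
Proof. by have [[]] := idx_chart c. Qed.

Lemma cinv_loc (c : idx A) (m : M) : dom c m -> cinv (sval c) (loc c m) = m.
Proof. by have [_ + _ _] := idx_chart c; apply. Qed.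

Lemma cinv_continuous (c : idx A) (m : M) : dom c m ->
  {for (loc c m : E), continuous (cinv (sval c))}.
Proof. by have [_ _ _] := idx_chart c; apply. Qed.

Lemma near_dom (c : idx A) (m : M) : dom c m -> \forall n \near m, dom c n.
Proof. by move=> cm; apply: open_nbhs_nbhs; split=> //; exact: dom_open. Qed.

(** The inverse chart is controlled only on the image of the chart.  As this
    image is open, every local identity at the coordinates of m can be checked
    at coordinates of points n. *)
Lemma near_chart (c : idx A) (m : M) (P : set M) : dom c m ->
  (\forall n \near m, P n) ->
  \forall x \near (loc c m : E), exists2 n, dom c n /\ P n & x = loc c n.
Proof.
move=> cm Pm.
have P' : \forall x \near (loc c m : E),
    dom c (cinv (sval c) x) /\ P (cinv (sval c) x).
  have nP : \forall n \near m, dom c n /\ P n.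
    by apply: filterS2 (near_dom cm) Pm => n.
  exact: (near_preimage (cinv_continuous cm) (cinv_loc cm) nP).
have [[_ oi] _ _ _] := idx_chart c.
have im : \forall x \near (loc c m : E), (cmap (sval c) @` cdom (sval c)) x.
  by apply: open_nbhs_nbhs; split=> //; exists m.
apply: filterS2 P' im => x xP [n cn nx]; exists n => //; split=> //.
by have := cinv_loc cn; move: xP; rewrite -nx /= => -[_ +] nE; rewrite nE.
Qed.

Lemma chart_image_open (c : idx A) (W : set M) :
  open W -> open (loc c @` (dom c `&` W) : set E).
Proof.
move=> oW; rewrite openE => _ [m [cm Wm] <-].
have nW : \forall n \near m, W n by exact: open_nbhs_nbhs.
apply: filterS (near_chart cm nW) => _ [n [cn Wn] ->].
by exists n.
Qed.

Lemma chart_image_openT (c : idx A) : open (loc c @` dom c : set E).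
Proof. by rewrite -[dom c]setIT; exact/chart_image_open/openT. Qed.

Lemma coherent_manifold : coherent2 A.
Proof.
have tl (i j : idx A) m : dom i m -> trans i j (loc i m) = loc j m.
  by move=> di; rewrite /= /ctrans /= (cinv_loc di).
have td (i j : idx A) m : dom i m -> dom j m -> twice_diff (trans i j) (loc i m).
  move=> di dj; apply: smooth_on_twice_diff.
  - exact: (chart_image_open i (dom_open j)).
  - exact: (atlas_compatible (svalP i) (svalP j)).
  - by exists m.
split=> //; split=> [i j m di _|i j m di dj|i m di|i j k m di dj dk].
- exact: tl.
- exact: twice_differentiable (td i j m di dj).
- have : \forall n \near (m : M), True by exact: filterT.
  by move=> /(near_chart di); apply: filterS => _ [n [? _] ->]; rewrite tl.
- by apply: filterS (near_chart di (near_dom dj)) => _ [n [? ?] ->]; rewrite !tl.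
Qed.

End ChartsAndMaps.

Lemma coherent_map (R : realType) (E F : completeNormedModType R)
  (M : banach_manifold E) (N : banach_manifold F) (f : M -> N) :
  smooth_map f -> coherent_mor2 (map_mor f).
Proof.
move=> [cf sf].
have ml (i : idx (coords_of M)) (j : idx (coords_of N)) m : dom i m ->
    mloc (map_mor f) i j (loc i m) = loc j (f m).
  by move=> di; rewrite /= (cinv_loc di).
have td (i : idx (coords_of M)) (j : idx (coords_of N)) m : dom i m -> dom j (f m) ->
    twice_diff (mloc (map_mor f) i j) (loc i m).
  move=> di dj; apply: smooth_on_twice_diff.
  - have oj : open (f @^-1` dom j) by exact: (continuousP f).1 cf _ (dom_open j).
    exact: (chart_image_open i oj).
  - exact: sf (svalP i) (svalP j).
  - by exists m.
split=> [x _ <- i j di dj|x _ <- i j]; last exact: td.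
split=> [||i' j' di' dj']; first exact: ml.
  exact: twice_differentiable (td i j x di dj).
have near_f (k : idx (coords_of N)) : dom k (f x) -> \forall n \near x, dom k (f n).
  by move=> dk; apply: near_preimage (cf x) erefl (near_dom dk).
have nP : \forall n \near x, [/\ dom i n, dom j (f n) & dom j' (f n)].
  by apply: filterS3 (near_dom di) (near_f _ dj) (near_f _ dj') => n.
apply: filterS (near_chart di' nP) => _ [n [? [? ? ?]] ->].
rewrite (trans_loc (coherent_manifold M).1)// !ml//.
by rewrite (trans_loc (coherent_manifold N).1).
Qed.

(** * Vector fields on Banach manifolds *)

Section VectorFields.
Context {R : realType} {E : completeNormedModType R} (M : banach_manifold E).
Notation A := (coords_of M).
Notation TM := (tangent A).
Implicit Types (c d : idx A) (m : M).

Let cohA : coherent A := (coherent_manifold M).1.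
Let cohA2 c d m : dom c m -> dom d m -> twice_diff (trans c d) (loc c m).
Proof. exact: (coherent_manifold M).2. Qed.

Lemma ppart_loc (X : M -> TM) c m : dom c m -> ppart X c (loc c m) = rep (X m) c.
Proof. by move=> cm; rewrite /ppart (cinv_loc cm). Qed.

(** The chain rule for the principal parts X_d = T'(T^-1 y) X_c(T^-1 y) of a
    vector field in two charts with transition map T. *)
Lemma is_diff_ppart (W : set M) (X : vsection W) c d m (dX : E -> E) :
  dom c m -> dom d m -> is_diff (loc c m : E) (ppart X c) dX ->
  is_diff (loc d m : E) (ppart X d) (fun h =>
    let k := 'd (trans d c) (loc d m) h in
    Deriv (Deriv (trans c d)) (loc c m) k (rep (X m) c)
    + 'd (trans c d) (loc c m) (dX k)).
Proof.
move=> cm dm dXc.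
pose g (y : E) : E * E := (trans d c y, ppart X c (trans d c y)).
have tdc := trans_loc cohA dm cm.
have dS : is_diff (loc d m : E) (trans d c) ('d (trans d c) (loc d m)).
  exact: differentiableP (trans_diff cohA dm cm).
rewrite -tdc in dXc.
have dg := is_diff_pair dS (is_diff_comp dS dXc).
have gE : g (loc d m) = (loc c m, rep (X m) c) by rewrite /g tdc ppart_loc.
have dT := @is_diff_Tmap _ _ _ (trans c d) (loc c m) (rep (X m) c) (cohA2 cm dm).
have {}dT : is_diff (g (loc d m)) (Tmap (trans c d)) (fun h =>
    ('d (trans c d) (loc c m) h.1,
     'd (Deriv (trans c d)) (loc c m) h.1 (rep (X m) c) +
     'd (trans c d) (loc c m) h.2)) by rewrite gE.
have dsnd := is_diff_comp (is_diff_comp dg dT) (is_diff_snd _).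
have {}dsnd := @near_is_diff _ _ _ _ (ppart X d) _ _ _ dsnd.
apply: is_diff_ext (dsnd _) _ => [|h] /=.
  apply: filterS (near_chart dm (near_dom cm)) => _ [n [dn cn] ->].
  rewrite [RHS]ppart_loc//.
  have gn : g (loc d n) = (loc c n, rep (X n) c).
    by rewrite /g (trans_loc cohA dn cn) ppart_loc.
  change ((Tmap (trans c d) (g (loc d n))).2 = rep (X n) d); rewrite gn.
  change ('d (trans c d) (loc c n) (rep (X n) c) = rep (X n) d).
  by rewrite -(rep_trans_at (vs_foot X n)).
by rewrite [in RHS]DerivE//; have [] := cohA2 cm dm.
Qed.

Lemma vfield_diff (W : set M) (X : vfield W) c m : W m -> dom c m ->
  differentiable (ppart X c) (loc c m : E).
Proof.
move=> Wm cm; have [d dm sX] := vf_smooth X Wm.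
have dX : is_diff (loc d m : E) (ppart X d) (Deriv (ppart X d) (loc d m)).
  apply: differentiable_Deriv; apply: smooth_on_differentiable sX _.
  by exists m.
exact: is_diff_differentiable (is_diff_ppart dm cm dX).
Qed.

Lemma diff_ppart_trans (W : set M) (X : vfield W) c d m u : W m ->
  dom c m -> dom d m ->
  'd (ppart X d) (loc d m : E) ('d (trans c d) (loc c m) u) =
  Deriv (Deriv (trans c d)) (loc c m) u (rep (X m) c)
  + 'd (trans c d) (loc c m) ('d (ppart X c) (loc c m : E) u).
Proof.
move=> Wm cm dm.
have [_ ->] := is_diff_ppart cm dm (differentiableP (vfield_diff X Wm cm)).
by rewrite /= (trans_inv cohA).
Qed.

(** The vector field with constant principal part u in the chart c.  The model
    space need not have bump functions, but such fields exist on chart domains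
    and are enough to test a connection. *)
Section ConstantField.
Context (c : idx A) (u : E).

Let X m : TM := match pselect (dom c m) with
  | left cm => tangent_in cohA u cm
  | right _ => tangent0 (A := A) m
  end.

Let Xfoot m : foot (X m) = m.
Proof. by rewrite /X; case: pselect. Qed.

Let Xout m : ~ dom c m -> forall d, rep (X m) d = 0.
Proof. by rewrite /X; case: pselect => // ? _ d; exact: tangent0E. Qed.

Definition const_section : vsection (dom c : set M) := VSection Xfoot Xout.

Lemma const_sectionE m : dom c m -> rep (const_section m) c = u.
Proof.
by rewrite /= /X; case: pselect => // cm _; exact: (tangent_in_self cohA).
Qed.

Lemma const_section_smooth m : dom c m -> exists2 d : idx A, dom d m &
  smooth_on (loc d @` (dom d `&` dom c)) (ppart const_section d).
Proof.
move=> cm; exists c => // n; rewrite setIid.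
apply: Ck_on_eq (chart_image_openT c) _ (smooth_on_cst _ u n) => _ [k ck <-].
by rewrite ppart_loc// const_sectionE.
Qed.

Definition const_field : vfield (dom c : set M) :=
  VField (dom_open c) const_section_smooth.

Lemma const_fieldE m : dom c m -> rep (const_field m) c = u.
Proof. exact: const_sectionE. Qed.

Lemma diff_const_field m h : dom c m ->
  'd (ppart const_field c) (loc c m : E) h = 0.
Proof.
move=> cm; have hd : is_diff (loc c m : E) (ppart const_field c) 0.
  apply: near_is_diff (is_diff_cst u (loc c m)).
  apply: filterS (near_chart cm (near_dom cm)) => _ [n [cn _] ->].
  by rewrite ppart_loc// const_sectionE.
by have [_ ->] := hd.
Qed.

End ConstantField.

Section Restriction.
Context (W W' : set M) (X : vfield W) (oW : open W') (WW : W' `<=` W).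

Let Y m : TM := if pselect (W' m) then X m else tangent0 (A := A) m.

Let Yfoot m : foot (Y m) = m.
Proof. by rewrite /Y; case: pselect => //= _; exact: vs_foot. Qed.

Let Yout m : ~ W' m -> forall d, rep (Y m) d = 0.
Proof. by rewrite /Y; case: pselect => // ? _ d; exact: tangent0E. Qed.

Definition restrict_section : vsection W' := VSection Yfoot Yout.

Lemma restrict_sectionE m : W' m -> restrict_section m = X m.
Proof. by rewrite /= /Y; case: pselect. Qed.

Lemma restrict_section_smooth m : W' m -> exists2 d : idx A, dom d m &
  smooth_on (loc d @` (dom d `&` W')) (ppart restrict_section d).
Proof.
move=> Wm; have [d dm sX] := vf_smooth X (WW Wm); exists d => // n.
apply: (@Ck_on_eq _ _ _ _ _ (ppart X d)) (chart_image_open d oW) _ _.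
  move=> _ [k [dk Wk] <-]; rewrite !ppart_loc//.
  by rewrite restrict_sectionE.
by apply: Ck_on_subset (sX n) => _ [k [dk /WW Wk] <-]; exists k.
Qed.

Definition restrict_field : vfield W' := VField oW restrict_section_smooth.

Lemma restrict_fieldE m : W' m -> restrict_field m = X m.
Proof. exact: restrict_sectionE. Qed.

End Restriction.

End VectorFields.

(** * Symmetric bilinear maps *)

Fact half_sum_linear (R : comNzRingType) (V : lmodType R) (a k : R) (p q p' q' : V) :
  k *: (a *: p + q + (a *: p' + q')) = a *: (k *: (p + p')) + k *: (q + q').
Proof.
have -> : a *: (k *: (p + p')) = k *: (a *: p + a *: p').
  by rewrite scalerA mulrC -scalerA scalerDr.
by rewrite -[RHS]scalerDr addrACA.
Qed.

Section Symmetrization.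
Context {R : realType} {E : normedModType R}.
Implicit Type B : bilin E.

Definition symf B (u v : E) : E := 2^-1 *: (B u v + B v u).

Lemma bilinPl B a x y v : B (a *: x + y) v = a *: B x v + B y v.
Proof. by rewrite clinD clinZ. Qed.

Lemma bilinPr B a x y v : B v (a *: x + y) = a *: B v x + B v y.
Proof. by rewrite clinD clinZ. Qed.

Lemma symf_subproof1 B u : linear (symf B u) /\
  forall v, `|symf B u v| <= (`|B| * `|u|) * `|v|.
Proof.
split=> [a x y|v]; rewrite /symf.
  by rewrite bilinPl bilinPr half_sum_linear.
have B1 x y : `|B x y| <= `|B| * `|x| * `|y|.
  by rewrite (le_trans (le_clin_norm _ _))// ler_wpM2r// le_clin_norm.
rewrite normrZ gtr0_norm ?invr_gt0// ler_pdivrMl//.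
rewrite (le_trans (ler_normD _ _))//.
rewrite (_ : 2 * _ = `|B| * `|u| * `|v| + `|B| * `|v| * `|u|); last by ring.
by rewrite lerD.
Qed.

Definition symB1 B (u : E) : clin E E :=
  mkclin (symf_subproof1 B u).1 (symf_subproof1 B u).2.

Lemma symB1_subproof B : linear (symB1 B) /\ forall u, `|symB1 B u| <= `|B| * `|u|.
Proof.
split=> [a x y|u].
  apply/val_inj/funext => v; rewrite [LHS]/(symf B _ v).
  by rewrite /symf bilinPl bilinPr half_sum_linear.
apply: clin_norm_le; first by rewrite mulr_ge0.
exact: (symf_subproof1 B u).2.
Qed.

Definition symB B : bilin E := mkclin (symB1_subproof B).1 (symB1_subproof B).2.

Lemma symBE B u v : symB B u v = 2^-1 *: (B u v + B v u). Proof. by []. Qed.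

Lemma symB_sym B u v : symB B u v = symB B v u.
Proof. by rewrite !symBE addrC. Qed.

Lemma symB_diag B u : symB B u u = B u u.
Proof.
rewrite symBE (_ : B u u + B u u = 2%:R *: B u u); last by rewrite scaler_nat mulr2n.
by rewrite scalerA mulVf ?scale1r// pnatr_eq0.
Qed.

Lemma symB_clin_subproof : linear symB /\ forall B, `|symB B| <= 1 * `|B|.
Proof.
split=> [a B C|B].
  apply/val_inj/funext => u; apply/val_inj/funext => v.
  rewrite [LHS]/(symf (a *: B + C) u v) /symf.
  have BE x y : (a *: B + C) x y = a *: B x y + C x y by [].
  by rewrite !BE half_sum_linear.
by rewrite mul1r; apply: clin_norm_le => // u; exact: (symB1_subproof B).2.
Qed.

(** Symmetrization is continuous and linear, so that it preserves the
    smoothness of Christoffel symbols. *)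
Definition symB_clin : clin (bilin E) (bilin E) :=
  mkclin symB_clin_subproof.1 symB_clin_subproof.2.

End Symmetrization.

(** Both values can be read off b(u + v, u + v) = b(u, u) + 2 b(u, v) + b(v, v).
    Symmetry is required at the pair (u, v) only: torsion free connections on
    the limit manifold provide it for the vectors of F, not for all of E_i. *)
Lemma polarization_at (R : realType) (E F : lmodType R) (b b' : E -> E -> F) u v :
  (forall w, {morph b w : x y / x + y}) -> (forall w, {morph b^~ w : x y / x + y}) ->
  (forall w, {morph b' w : x y / x + y}) -> (forall w, {morph b'^~ w : x y / x + y}) ->
  b u v = b v u -> b' u v = b' v u ->
  b u u = b' u u -> b v v = b' v v -> b (u + v) (u + v) = b' (u + v) (u + v) ->
  b u v = b' u v.
Proof.
move=> bDr bDl bDr' bDl' bs bs' bu bv.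
have bE : b (u + v) (u + v) = b u u + b u v + (b u v + b v v).
  by rewrite [LHS]bDl !bDr -bs.
have bE' : b' (u + v) (u + v) = b' u u + b' u v + (b' u v + b' v v).
  by rewrite [LHS]bDl' !bDr' -bs'.
have half (w : F) : 2^-1 *: (w + w) = w.
  rewrite (_ : w + w = 2%:R *: w); last by rewrite scaler_nat mulr2n.
  by rewrite scalerA mulVf ?scale1r// pnatr_eq0.
rewrite bE bE' bu bv => buv.
rewrite -(half (b u v)) -(half (b' u v)); congr (_ *: _).
apply: (@addIr _ (b' v v)); apply: (@addrI _ (b' u u)).
have e x : b' u u + (x + x + b' v v) = b' u u + x + (x + b' v v).
  by rewrite !addrA.
by rewrite !e.
Qed.

Lemma polarization (R : realType) (E F : lmodType R) (b b' : E -> E -> F) :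
  (forall u v w, b (u + v) w = b u w + b v w) ->
  (forall u v w, b' (u + v) w = b' u w + b' v w) ->
  (forall u v, b u v = b v u) -> (forall u v, b' u v = b' v u) ->
  (forall u, b u u = b' u u) -> forall u v, b u v = b' u v.
Proof.
move=> bD bD' bs bs' bb u v; apply: polarization_at => //.
- by move=> w x y; rewrite bs bD !(bs _ w).
- by move=> w x y; rewrite bD.
- by move=> w x y; rewrite bs' bD' !(bs' _ w).
- by move=> w x y; rewrite bD'.
Qed.

(** * Connections and sprays on a Banach manifold *)

Section ConnectionsAndSprays.
Context {R : realType} {E : completeNormedModType R} (M : banach_manifold E).
Notation A := (coords_of M).
Notation TM := (tangent A).
Notation TTM := (tangent (Tan A)).
Implicit Types (c d : idx A) (m : M) (G : E -> bilin E).

Let cohA : coherent A := (coherent_manifold M).1.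
Let cohA2 c d m : dom c m -> dom d m -> twice_diff (trans c d) (loc c m).
Proof. exact: (coherent_manifold M).2. Qed.

(** The derivative of a constant field vanishes, which isolates the Christoffel
    symbol. *)
Lemma conn_components_const (D : nabla_op M) c G m u v : conn_components D c G ->
  dom c m -> rep (D _ (const_field c u) (const_field c v) m) c
    = - G (loc c m) u v.
Proof.
move=> [_ DG] cm; rewrite DG// diff_const_field// sub0r.
by rewrite !const_fieldE.
Qed.

Lemma conn_components_unique (D : nabla_op M) c G G' m u v :
  conn_components D c G -> conn_components D c G' -> dom c m ->
  G (loc c m) u v = G' (loc c m) u v.
Proof.
move=> DG DG' cm; apply: oppr_inj.
by rewrite -(conn_components_const _ _ DG)// -(conn_components_const _ _ DG').
Qed.

(** Compare the values at m of nabla on two constant fields of the chart c, read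
    in c and in d.  In d, the derivative of the field v along u is T''(u, v),
    with T the transition map. *)
Lemma conn_components_trans (D : nabla_op M) c d G G' m u v :
  conn_components D c G -> conn_components D d G' -> dom c m -> dom d m ->
  G' (loc d m) ('d (trans c d) (loc c m) u) ('d (trans c d) (loc c m) v) =
  Deriv (Deriv (trans c d)) (loc c m) u v
  + 'd (trans c d) (loc c m) (G (loc c m) u v).
Proof.
move=> DG DG' cm dm.
pose w := D _ (const_field c u) (const_field c v) m.
have fw : foot w = m by exact: vs_foot.
have rw := rep_trans_at fw cm dm.
have repX (x : E) : rep (const_field c x m) d = 'd (trans c d) (loc c m) x.
  by rewrite (rep_trans_at (vs_foot (const_field c x) m) cm dm) const_fieldE.
move: rw; rewrite (conn_components_const _ _ DG)// linearN /w DG'.2// !repX.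
rewrite [X in X - _](diff_ppart_trans (const_field c v) u cm cm dm).
rewrite [X in _ + 'd _ _ X - _](_ : _ = 0); last exact: diff_const_field.
rewrite [X in _ + X - _]linear0 addr0.
rewrite const_fieldE// => /eqP.
by rewrite subr_eq => /eqP ->; rewrite addrAC addNr add0r.
Qed.

(** On the diagonal, the transformation law of Christoffel symbols is the
    second component of T(T f), with f the transition map.  Hence the vectors
    (v, G(v, v)) of the charts represent one element of TTM. *)
Section SprayOfConnection.
Variables (D : nabla_op M) (G : forall c, E -> bilin E).
Hypothesis DG : forall c, conn_components D c (G c).

Let f (v : TM) c : E * E := (rep v c, G c (loc c (foot v)) (rep v c) (rep v c)).

Let fP (v : TM) (c d : idx (Tan A)) : dom c v -> dom d v ->
  f v d = 'd (@trans _ (Tan A) c d) (@loc _ (Tan A) c v) (f v c).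
Proof.
move=> cv dv; have [_ ->] := is_diff_Tmap (rep v c) (cohA2 cv dv).
rewrite /f /= -(rep_trans cv dv) (rep_trans cv dv).
rewrite (conn_components_trans _ _ (DG c) (DG d) cv dv).
by rewrite DerivE//; have [] := cohA2 cv dv.
Qed.

Definition spray_of_connection (v : TM) : TTM := glue_tangent (@fP v).

Lemma spray_of_connectionE v c G' : conn_components D c G' -> dom c (foot v) ->
  rep (spray_of_connection v) c =
  (rep v c, G' (loc c (foot v)) (rep v c) (rep v c)).
Proof.
move=> DG' cv; rewrite /spray_of_connection (@glue_tangentE _ (Tan A))// /f.
by rewrite (conn_components_unique _ _ (DG c) DG').
Qed.

End SprayOfConnection.

Lemma spray_components_sym (D : nabla_op M) (z : TM -> TTM) c G :
  conn_components D c G ->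
  (forall v : TM, dom c (foot v) ->
     rep (z v) c = (rep v c, G (loc c (foot v)) (rep v c) (rep v c))) ->
  spray_components z c (fun x => symB (G x)).
Proof.
move=> [sG _] zG; split=> [n|m cm u v|v cv].
- exact: (Ck_on_clin_comp (symB_clin (E := E)) (chart_image_openT c) (sG n)).
- exact: symB_sym.
- by rewrite symB_diag zG.
Qed.

Lemma connection_spray (D : nabla_op M) : is_connection D ->
  exists z : TM -> TTM, is_spray z /\ forall c G, conn_components D c G ->
    forall v : TM, dom c (foot v) ->
    rep (z v) c = (rep v c, G (loc c (foot v)) (rep v c) (rep v c)).
Proof.
move=> /choice[G DG]; exists (spray_of_connection DG).
have zG c G' : conn_components D c G' -> forall v : TM, dom c (foot v) ->
    rep (spray_of_connection DG v) c =
    (rep v c, G' (loc c (foot v)) (rep v c) (rep v c)).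
  by move=> DG' v cv; exact: spray_of_connectionE.
split=> //; split=> // c; exists (fun x => symB (G c x)).
exact: spray_components_sym (DG c) (zG c _ (DG c)).
Qed.

Section ConnectionOfSpray.
Variables (z : TM -> TTM).

Lemma spray_components_diag c G m u : spray_components z c G ->
  forall cm : dom c m, rep (z (tangent_in cohA u cm)) c = (u, G (loc c m) u u).
Proof. by move=> [_ _ zG] cm; rewrite zG// tangent_in_self. Qed.

Lemma spray_components_unique c G G' m u v : spray_components z c G ->
  spray_components z c G' -> dom c m -> G (loc c m) u v = G' (loc c m) u v.
Proof.
move=> zG zG' cm; move: u v; apply: polarization => [u v w|u v w|||u].
- by rewrite clinD.
- by rewrite clinD.
- by case: zG => _ + _; apply.
- by case: zG' => _ + _; apply.
- have := spray_components_diag u zG cm; rewrite (spray_components_diag u zG' cm).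
  by case.
Qed.

Hypothesis zfoot : forall v, foot (z v) = v.

(** The spray gives the transformation law on the diagonal; it extends to all
    pairs of vectors by polarization, both sides being symmetric. *)
Lemma spray_components_trans c d G G' m u v :
  spray_components z c G -> spray_components z d G' -> dom c m -> dom d m ->
  G' (loc d m) ('d (trans c d) (loc c m) u) ('d (trans c d) (loc c m) v) =
  Deriv (Deriv (trans c d)) (loc c m) u v
  + 'd (trans c d) (loc c m) (G (loc c m) u v).
Proof.
move=> zG zG' cm dm; move: u v.
apply: polarization => [u v w|u v w|u v|u v|u].
- by rewrite linearD clinD.
- by rewrite !clinD !clinDE linearD addrACA.
- by case: zG' => _ + _; apply.
- rewrite (second_derivative_sym _ _ (cohA2 cm dm)).
  by case: zG => _ /(_ m cm) -> _.
- pose w := tangent_in cohA u cm.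
  have zw : foot (z w) = w by exact: zfoot.
  have cw : @dom _ (Tan A) c (foot (z w)) by rewrite zw.
  have dw : @dom _ (Tan A) d (foot (z w)) by rewrite zw.
  have rd : rep w d = 'd (trans c d) (loc c m) u by rewrite tangent_inE.
  have rc : rep w c = u by exact: tangent_in_self.
  have [_ _ /(_ w dm) zd] := zG'.
  have := rep_trans cw dw; rewrite zd zw rd (spray_components_diag u zG cm).
  have [_ ->] := is_diff_Tmap (rep w c) (cohA2 cm dm).
  rewrite rc => -[->].
  by rewrite DerivE//; have [] := cohA2 cm dm.
Qed.

Variable (G : forall c, E -> bilin E).
Hypothesis zG : forall c, spray_components z c (G c).

(** The term T''(X, Y) produced by the derivative of Y in another chart cancels
    against the one in the transformation law of G. *)
Section AtPoint.
Variables (W : set M) (X Y : vfield W) (m : M) (Wm : W m).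

Let f c : E := 'd (ppart Y c) (loc c m : E) (rep (X m) c)
  - G c (loc c m) (rep (X m) c) (rep (Y m) c).

Let fP c d : dom c m -> dom d m -> f d = 'd (trans c d) (loc c m) (f c).
Proof.
move=> cm dm.
have repT (Z : vfield W) : rep (Z m) d = 'd (trans c d) (loc c m) (rep (Z m) c).
  exact: rep_trans_at (vs_foot Z m) cm dm.
rewrite /f !repT (spray_components_trans _ _ (zG c) (zG d) cm dm).
rewrite [X in X - _ = _](diff_ppart_trans Y (rep (X m) c) Wm cm dm).
rewrite [RHS]linearB.
by rewrite opprD addrACA subrr add0r.
Qed.

Definition nabla_at : TM := glue_tangent fP.

End AtPoint.

Section Field.
Variables (W : set M) (X Y : vfield W).

Let S m : TM := match pselect (W m) with
  | left Wm => nabla_at X Y Wm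
  | right _ => tangent0 (A := A) m
  end.

Let Sfoot m : foot (S m) = m.
Proof. by rewrite /S; case: pselect. Qed.

Let Sout m : ~ W m -> forall d, rep (S m) d = 0.
Proof. by rewrite /S; case: pselect => // ? _ d; exact: tangent0E. Qed.

Definition connection_of_spray : vsection W := VSection Sfoot Sout.

End Field.

Lemma connection_of_sprayP c G' : spray_components z c G' ->
  conn_components connection_of_spray c G'.
Proof.
move=> zG'; split=> [|W X Y m Wm cm]; first by case: zG'.
rewrite /=; case: pselect => // Wm'; rewrite glue_tangentE//.
by rewrite (spray_components_unique _ _ (zG c) zG').
Qed.

End ConnectionOfSpray.

Lemma spray_connection (z : TM -> TTM) : is_spray z ->
  exists D : nabla_op M, is_connection D /\
    forall c G, spray_components z c G -> conn_components D c G.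
Proof.
move=> [zf /choice[G zG]]; exists (connection_of_spray zf zG).
split=> [c|c G']; last exact: connection_of_sprayP.
by exists (G c); exact: connection_of_sprayP.
Qed.

End ConnectionsAndSprays.

(** * Projective limits *)

Lemma plim_ext (A : nat -> Type) (b : forall j i, A j -> A i -> Prop)
  (x y : plim b) : (forall i, x i = y i) -> x = y.
Proof.
case: x y => [f fP] [g gP] /= fg.
have {}fg : f = g by apply: functional_extensionality_dep.
by move: fP gP; rewrite -fg => fP gP; rewrite (Prop_irrelevance fP gP).
Qed.

Lemma prod_topology_continuous (T : topologicalType) (A : nat -> topologicalType)
  (f : T -> prod_topology A) (x : T) :
  (forall i, {for x, continuous (fun t => f t i)}) -> {for x, continuous f}.
Proof.
move=> cf; apply/cvg_sup => i Q.
rewrite (@nbhsE (initial_topology _)) => -[B [[C oC <-] Cx] BQ].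
apply: filterS BQ _; apply: (cf i C).
by apply: open_nbhs_nbhs.
Qed.

Section ProjectiveSystem.
Context {R : realType} (S : proj_system R).
Notation E := (mspace S).
Notation CM i := (coords_of (mani S i)).
Notation rho j i := (@rho R S j i).
Notation bond j i := (@bond R S j i).
Notation bmor j i := (map_mor (bond j i)).

Let coh i : coherent (CM i) := (coherent_manifold (mani S i)).1.
Let coh2 i : coherent2 (CM i) := coherent_manifold (mani S i).
Let cohT i : coherent (Tan (CM i)) := coherent_Tan (coh2 i).

Lemma coherent_bond i j : (i <= j)%N -> coherent_mor2 (bmor j i).
Proof. by move=> ij; apply: coherent_map; exact: bond_smooth. Qed.

Lemma rho_is_diff i j x : (i <= j)%N -> is_diff x (rho j i) (rho j i).
Proof.
by move=> ij; apply: linear_is_diff; [exact: rho_linear|exact: rho_continuous].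
Qed.

Lemma rhoPZ i j a x y : (i <= j)%N ->
  rho j i (a *: x + y) = a *: rho j i x + rho j i y.
Proof. by move=> ij; rewrite rho_linear. Qed.

Lemma rhoD i j x y : (i <= j)%N -> rho j i (x + y) = rho j i x + rho j i y.
Proof. by move=> ij; rewrite -[x]scale1r rhoPZ// !scale1r. Qed.

Lemma rho0 i j : (i <= j)%N -> rho j i 0 = 0.
Proof. by move=> ij; apply: (addIr (rho j i 0)); rewrite -rhoD// !add0r. Qed.

Lemma rhoZ i j a x : (i <= j)%N -> rho j i (a *: x) = a *: rho j i x.
Proof. by move=> ij; rewrite -[a *: x]addr0 rhoPZ// rho0// addr0. Qed.

Lemma rhoB i j x y : (i <= j)%N -> rho j i (x - y) = rho j i x - rho j i y.
Proof. by move=> ij; rewrite rhoD// -scaleN1r rhoZ// scaleN1r. Qed.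

Section LimitChart.
Variable c : lchart S.

Lemma near_bond_rho i j (m : mani S j) : (i <= j)%N -> dom (c j) m ->
  {near (loc (c j) m : E j), rho j i =1 mloc (bmor j i) (c j) (c i)}.
Proof.
move=> ij cm; apply: filterS (near_chart cm (near_dom cm)) => _ [n [cn _] ->].
by rewrite /= -(lc_bond ij cn).2; have /= -> := cinv_loc cn.
Qed.

Lemma is_diff_bond i j (m : mani S j) : (i <= j)%N -> dom (c j) m ->
  is_diff (loc (c j) m : E j) (mloc (bmor j i) (c j) (c i)) (rho j i).
Proof.
by move=> ij cm; apply: near_is_diff (near_bond_rho ij cm) (rho_is_diff _ ij).
Qed.

(** Limit charts turn the bonding maps of M into the linear maps rho, which are
    their own differentials; so one comparison through rho settles the bonding
    condition in TM, and likewise in TTM. *)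
Lemma graph_Tbond i j (v : tangent (CM j)) (w : tangent (CM i)) : (i <= j)%N ->
  dom (c j) (foot v) -> bond j i (foot v) = foot w ->
  rep w (c i) = rho j i (rep v (c j)) -> graph (Tmor (bmor j i)) v w.
Proof.
move=> ij cv vw rvw; have [ci _] := lc_bond ij cv.
apply: (@graph_Tmor _ _ _ _ v w (c j) (c i)) => //.
- exact: (coherent_bond ij).1.
- by rewrite -vw.
- by have [_ ->] := is_diff_bond ij cv.
Qed.

Lemma rep_Tbond i j (v : tangent (CM j)) (w : tangent (CM i)) : (i <= j)%N ->
  dom (c j) (foot v) -> graph (Tmor (bmor j i)) v w ->
  rep w (c i) = rho j i (rep v (c j)).
Proof.
move=> ij cv [/= vw rvw]; have [ci _] := lc_bond ij cv.
rewrite (rvw (c j) (c i)) -?vw//.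
by have [_ ->] := is_diff_bond ij cv.
Qed.

Lemma graph_TTbond i j (V : tangent (Tan (CM j))) (W : tangent (Tan (CM i))) :
  (i <= j)%N -> dom (c j) (foot (foot V)) ->
  graph (Tmor (bmor j i)) (foot V) (foot W) ->
  rep W (c i) = (rho j i (rep V (c j)).1, rho j i (rep V (c j)).2) ->
  graph (Tmor (Tmor (bmor j i))) V W.
Proof.
move=> ij cV VW rVW; have [ci _] := lc_bond ij cV.
have [VW1 _] := VW; rewrite /= in VW1.
apply: (@graph_Tmor _ _ _ _ V W (c j : idx (Tan (CM j))) (c i)) => //.
- by apply: coherent_Tmor => //; exact: coherent_bond.
- by rewrite /= -VW1.
- have dr : is_diff (loc (c j) (foot (foot V)), rep (foot V) (c j))
      (fun p : E j * E j => (rho j i p.1, rho j i p.2))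
      (fun p : E j * E j => (rho j i p.1, rho j i p.2)).
    apply: linear_is_diff => [a p q|p].
      by rewrite /= !rhoPZ.
    apply: differentiable_continuous; apply: is_diff_differentiable.
    apply: is_diff_pair.
      exact: is_diff_comp (is_diff_fst p) (rho_is_diff _ ij).
    exact: is_diff_comp (is_diff_snd p) (rho_is_diff _ ij).
  have nT : {near (loc (c j) (foot (foot V)), rep (foot V) (c j)),
      Tmap (rho j i) =1 Tmap (mloc (bmor j i) (c j) (c i))}.
    apply: near_Tmap (near_bond_rho ij cV) _.
    by apply: nearW => y; case: (rho_is_diff y ij).
  have nT' : {near (loc (c j) (foot (foot V)), rep (foot V) (c j)),
      (fun p : E j * E j => (rho j i p.1, rho j i p.2)) =1
      Tmap (mloc (bmor j i) (c j) (c i))}.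
    apply: filterS nT => p <-; rewrite /Tmap.
    by have [_ ->] := rho_is_diff p.1 ij.
  by have [_ /= ->] := near_is_diff nT' dr.
Qed.

Lemma at_point_ex (m : LM S) : ldom c m -> exists x : LF S, at_point c m x.
Proof.
move=> cm.
have xP i j : (i <= j)%N -> rho j i (loc (c j) (m j)) = loc (c i) (m i).
  by move=> ij; rewrite -(lc_bond ij (cm j)).2 (pfunP m ij).
by exists (PLim xP).
Qed.

Lemma rep_limit_ex (v : LT S) : ldom c (lfoot v) ->
  exists u : LF S, forall i, u i = rep (v i) (c i).
Proof.
move=> cv.
have uP i j : (i <= j)%N -> rho j i (rep (v j) (c j)) = rep (v i) (c i).
  by move=> ij; rewrite (rep_Tbond ij (cv j) (pfunP v ij)).
by exists (PLim uP).
Qed.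

Lemma line_subproof (x u : LF S) (t : R) i j : (i <= j)%N ->
  rho j i (t *: u j + x j) = t *: u i + x i.
Proof. by move=> ij; rewrite rhoPZ// (pfunP u ij) (pfunP x ij). Qed.

(** As phi(U) is open in F, short segments in F lift to the limit manifold. *)
Lemma near_line (W : set (LM S)) (m : LM S) (x u : LF S) :
  plim_open W -> W m -> ldom c m -> at_point c m x ->
  \forall t \near (0 : R), exists n : LM S,
    [/\ ldom c n, W n & forall i, loc (c i) (n i) = t *: u i + x i].
Proof.
move=> [B oB WE] Wm cm xm; have [B' oB' imE] := lc_img_open c.
pose l (t : R) : LF S := PLim (line_subproof x u t).
have l0 i : l 0 i = loc (c i) (m i) by rewrite /= scale0r add0r xm.
have lc i : {for 0, continuous (fun t => l t i)}.
  exact: differentiable_continuous (is_diff_differentiable (is_diff_line _ _ _)).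
have n1 : \forall t \near (0 : R), B' (pfun (l t)).
  have cl : {for (0 : R), continuous (fun t => pfun (l t) : prod_topology E)}.
    exact: prod_topology_continuous.
  apply: cl; apply: open_nbhs_nbhs; split=> //.
  have : [set x : LF S | exists2 m : LM S,
    (forall i, dom (c i) (m i)) & forall i, x i = loc (c i) (m i)] (l 0).
    by exists m.
  by rewrite imE.
pose k (t : R) i : mani S i := cinv (sval (c i)) (l t i).
have k0 i : k 0 i = m i by rewrite /k l0 (cinv_loc (cm i)).
have n2 : \forall t \near (0 : R), B (k t).
  have ck : {for (0 : R), continuous (k : R -> prod_topology (fun i => mani S i))}.
    apply: prod_topology_continuous => i; rewrite /k.
    apply: (@continuous_comp _ _ _ (fun t => l t i)); first exact: lc.
    by rewrite l0; exact: cinv_continuous (cm i).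
  apply: ck; apply: open_nbhs_nbhs; split=> //.
  have -> : k 0 = pfun m by apply: functional_extensionality_dep.
  by move: Wm; rewrite WE.
apply: filterS2 n1 n2 => t lt kt.
have [n cn ln] : [set x : LF S | exists2 m : LM S,
    (forall i, dom (c i) (m i)) & forall i, x i = loc (c i) (m i)] (l t).
  by rewrite imE.
exists n; split=> // [|i]; last by rewrite -ln.
have -> : W = @pfun _ _ @^-1` B by [].
rewrite /preimage/=; suff <- : k t = pfun n by [].
by apply: functional_extensionality_dep => i; rewrite /k ln (cinv_loc (cn i)).
Qed.

End LimitChart.
End ProjectiveSystem.

(** * Vector fields and connections on the limit manifold *)

Section LimitManifold.
Context {R : realType} (M : proj_manifold R).
Notation E := (mspace M).
Notation Mi i := (mani M i).
Notation CM i := (coords_of (mani M i)).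
Notation rho j i := (@rho R M j i).
Notation bond j i := (@bond R M j i).
Notation bmor j i := (map_mor (bond j i)).
Implicit Types (c : lchart M) (m : LM M).

Lemma LM_bond m i j : (i <= j)%N -> bond j i (m j) = m i.
Proof. by move=> ij; exact: (pfunP m ij). Qed.

Lemma LT_ext (v w : LT M) c : lfoot v = lfoot w -> ldom c (lfoot v) ->
  (forall i, rep (v i) (c i) = rep (w i) (c i)) -> v = w.
Proof.
move=> vw cv rvw; apply: plim_ext => i.
apply: (@tangent_eq_in_chart _ _ _ _ (c i)); last exact: rvw.
  by move: vw => /(congr1 (fun m : LM M => m i)).
exact: (cv i).
Qed.

Lemma lsection_ext (W : set (LM M)) (X Y : lsection W) :
  (forall m, W m -> ls X m = ls Y m) -> X = Y.
Proof.
move=> XY; have {}XY : ls X = ls Y.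
  apply/funext => m; have [/XY//|nW] := pselect (W m).
  apply: plim_ext => i; apply: tangent_ext.
    have XYm := etrans (ls_foot X m) (esym (ls_foot Y m)).
    exact: (congr1 (fun m : LM M => m i) XYm).
  by move=> d; rewrite !ls_out.
case: X Y XY => [X p q] [Y p' q'] /= XY; move: p q p' q'; rewrite XY => p q p' q'.
by rewrite (Prop_irrelevance p p') (Prop_irrelevance q q').
Qed.

Section GlueSection.
Variables (W : set (LM M)) (f : forall i, Mi i -> tangent (CM i)).
Hypothesis f_foot : forall i (m : Mi i), foot (f m) = m.
Hypothesis f_bond : forall m, W m -> forall i j, (i <= j)%N ->
  graph (Tmor (bmor j i)) (f (m j)) (f (m i)).

Let h m i : tangent (CM i) :=
  if pselect (W m) then f (m i) else tangent0 (A := CM i) (m i).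

Let hP m i j : (i <= j)%N -> graph (Tmor (bmor j i)) (h m j) (h m i).
Proof.
move=> ij; rewrite /h; case: pselect => Wm; first exact: f_bond.
split=> [|a b _ _]; first exact: LM_bond.
rewrite [LHS](_ : _ = 0); last exact: tangent0E.
by rewrite [X in 'd _ _ X](_ : _ = 0) ?linear0//; exact: tangent0E.
Qed.

Let X m : LT M := PLim (@hP m).

Let Xfoot m : lfoot (X m) = m.
Proof.
by apply: plim_ext => i; rewrite /= /h; case: pselect => [?|?] //=; exact: f_foot.
Qed.

Let Xout m : ~ W m -> forall i d, rep (X m i) d = 0.
Proof.
move=> nW i d; rewrite -[X m i]/(h m i) /h; case: pselect => // ?.
exact: tangent0E.
Qed.

Definition glue_lsection : lsection W := LSection Xfoot Xout.

Lemma glue_lsectionE m i : W m -> glue_lsection m i = f (m i).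
Proof. by move=> Wm; rewrite /= /h; case: pselect. Qed.

End GlueSection.

Lemma const_lfield_ex c (u : LF M) : exists X : lfield (ldom c),
  is_lim_field (fun i => const_field (c i) (u i)) X.
Proof.
pose f i (m : Mi i) : tangent (CM i) := const_field (c i) (u i) m.
have fb i j (m : Mi j) : (i <= j)%N -> dom (c j) m ->
    graph (Tmor (bmor j i)) (f j m) (f i (bond j i m)).
  move=> ij cm; have [ci _] := lc_bond ij cm.
  have ff k (n : Mi k) : foot (f k n) = n by exact: vs_foot.
  apply: (@graph_Tbond _ _ c); rewrite ?ff//.
  by rewrite /f !const_fieldE// (pfunP u ij).
have f_bond m : ldom c m -> forall i j, (i <= j)%N ->
    graph (Tmor (bmor j i)) (f j (m j)) (f i (m i)).
  by move=> cm i j ij; rewrite -(LM_bond m ij); exact: fb (cm j).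
have f_foot i (m : Mi i) : foot (f i m) = m by exact: vs_foot.
pose X := glue_lsection f_foot f_bond.
have Xlim : is_lim_field (fun i => const_field (c i) (u i)) X.
  split=> // [i j ij m cm|m cm i]; last by rewrite glue_lsectionE.
  by split; [exact: (lc_bond ij cm).1|exact: fb].
have Xl : exists Wi (Xi : forall i, vfield (Wi i)), is_lim_field Xi X.
  by exists (fun i => dom (c i)), (fun i => const_field (c i) (u i)).
by exists (LField (lc_open c) Xl).
Qed.

(** Vectors of F extend to constant limit fields in a limit chart, and nabla of
    two such fields is minus the Christoffel symbol. *)
Lemma lim_conn_components_unique (N : lnabla_op M)
  (D D' : forall i, nabla_op (Mi i)) c G G' m x (u v : LF M) i :
  is_lim_nabla N D -> is_lim_nabla N D' ->
  lim_conn_components D c G -> lim_conn_components D' c G' ->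
  ldom c m -> at_point c m x ->
  G x i (u i) (v i) = G' x i (u i) (v i).
Proof.
move=> ND ND' [Gi DG [_ GE]] [Gi' DG' [_ GE']] cm xm.
have [X Xu] := const_lfield_ex c u; have [Y Yv] := const_lfield_ex c v.
rewrite (GE _ cm _ xm) (GE' _ cm _ xm) xm; apply: oppr_inj.
rewrite -(conn_components_const _ _ (DG i) (cm i)).
rewrite -(conn_components_const _ _ (DG' i) (cm i)).
by rewrite -(ND _ _ _ _ _ _ Xu Yv m cm i) (ND' _ _ _ _ _ _ Xu Yv m cm i).
Qed.

(** X and Y need not come with the same domains W_i: the families are
    restricted to the intersections, which have the same limit W. *)
Lemma common_fields (W : set (LM M)) (X Y : lfield W) :
  exists Wi (Xi Yi : forall i, vfield (Wi i)),
    is_lim_field Xi X /\ is_lim_field Yi Y.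
Proof.
have [W1 [X1 [WE1 b1 e1]]] := lf_lim X; have [W2 [Y2 [WE2 b2 e2]]] := lf_lim Y.
pose Wi i := W1 i `&` W2 i.
have oW i : open (Wi i) by apply: openI; exact: vf_open.
exists Wi, (fun i => restrict_field (X1 i) (oW i) (@subIsetl _ _ _)),
  (fun i => restrict_field (Y2 i) (oW i) (@subIsetr _ _ _)).
have WE : W = [set m | forall i, Wi i (m i)].
  apply/seteqP; split=> m.
    move=> Wm i; split.
      by move: i; have : W m by []; rewrite {1}WE1.
    by move: i; have : W m by []; rewrite {1}WE2.
  by move=> Wm; rewrite WE1 => i; case: (Wm i).
have Wb i j : (i <= j)%N -> forall m : Mi j, Wi j m -> Wi i (bond j i m).
  by move=> ij m [m1 m2]; split; [exact: (b1 i j ij m m1).1|exact: (b2 i j ij m m2).1].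
have WW m : W m -> forall i, Wi i (m i) by rewrite {1}WE.
split; (split; [exact: WE|move=> i j ij m Wm|move=> m Wm i]).
- split; first exact: Wb.
  rewrite !restrict_fieldE//; first exact: (b1 i j ij m Wm.1).2.
  exact: Wb.
- by rewrite restrict_fieldE ?e1//; exact: WW.
- split; first exact: Wb.
  rewrite !restrict_fieldE//; first exact: (b2 i j ij m Wm.2).2.
  exact: Wb.
- by rewrite restrict_fieldE ?e2//; exact: WW.
Qed.

(** A limit field Y may be the limit of several families Y_i, as only the
    projections of W to M_i matter.  The derivatives of the Y_i in the
    directions of F agree, because they are taken along segments which lift to
    W. *)
Lemma diff_lim_field_unique (W : set (LM M)) (Y : lfield W) Wi Wi'
  (Yi : forall i, vfield (Wi i)) (Yi' : forall i, vfield (Wi' i)) c m (u : LF M) i :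
  is_lim_field Yi Y -> is_lim_field Yi' Y -> W m -> ldom c m ->
  'd (ppart (Yi i) (c i)) (loc (c i) (m i) : E i) (u i) =
  'd (ppart (Yi' i) (c i)) (loc (c i) (m i) : E i) (u i).
Proof.
move=> [WE bY YE] [WE' bY' YE'] Wm cm; have [x xm] := at_point_ex cm.
have Wmi : Wi i (m i) by move: Wm; rewrite {1}WE.
have Wmi' : Wi' i (m i) by move: Wm; rewrite {1}WE'.
pose l (t : R) := t *: u i + x i.
have l0 : l 0 = loc (c i) (m i) by rewrite /l scale0r add0r xm.
have dl := is_diff_line (u i) (x i) 0.
have dcomp (f : E i -> E i) : differentiable f (loc (c i) (m i) : E i) ->
    is_diff (0 : R) (f \o l) (fun h => 'd f (loc (c i) (m i) : E i) (h *: u i)).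
  move=> df; apply: (is_diff_comp dl).
  by rewrite -/(l 0) l0; exact: differentiableP.
have d1 := dcomp _ (vfield_diff (Yi i) Wmi (cm i)).
have d2 := dcomp _ (vfield_diff (Yi' i) Wmi' (cm i)).
have ll : {near (0 : R), ppart (Yi i) (c i) \o l =1 ppart (Yi' i) (c i) \o l}.
  apply: filterS (near_line u (lf_open Y) Wm cm xm) => t [n [cn Wn ln]].
  by rewrite /= /l -ln !(ppart_loc _ (cn i)) -YE// -YE'.
have := is_diff_unique (near_is_diff ll d1) d2.
by move=> /(congr1 (fun f => f 1)); rewrite scale1r.
Qed.

(** In limit charts Y_i o rho = rho o Y_j near the coordinates of m; this
    identity is differentiated in the direction of F. *)
Lemma diff_lim_field_bond (W : set (LM M)) (Y : lfield W) Wi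
  (Yi : forall i, vfield (Wi i)) c m (u : LF M) i j : (i <= j)%N ->
  is_lim_field Yi Y -> W m -> ldom c m ->
  'd (ppart (Yi i) (c i)) (loc (c i) (m i) : E i) (u i) =
  rho j i ('d (ppart (Yi j) (c j)) (loc (c j) (m j) : E j) (u j)).
Proof.
move=> ij [WE bY YE] Wm cm.
have WW k : Wi k (m k) by move: k; move: Wm; rewrite {1}WE.
have lE : loc (c i) (m i) = rho j i (loc (c j) (m j)).
  by rewrite -(lc_bond ij (cm j)).2 LM_bond.
have d1 := is_diff_comp (differentiableP (vfield_diff (Yi j) (WW j) (cm j)))
  (rho_is_diff _ ij).
have di := differentiableP (vfield_diff (Yi i) (WW i) (cm i)).
have d2 := is_diff_comp (rho_is_diff (loc (c j) (m j) : E j) ij) (_ : is_diff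
  (rho j i (loc (c j) (m j))) (ppart (Yi i) (c i))
  ('d (ppart (Yi i) (c i)) (loc (c i) (m i) : E i))).
rewrite -lE in d2; have {}d2 := d2 di.
have nW : \forall n \near m j, Wi j n.
  by apply: open_nbhs_nbhs; split; [exact: vf_open (Yi j)|].
have near12 : {near (loc (c j) (m j) : E j),
    rho j i \o ppart (Yi j) (c j) =1 ppart (Yi i) (c i) \o rho j i}.
  apply: filterS (near_chart (cm j) nW) => _ [n [cn Wn] ->].
  have [Wb gr] := bY i j ij n Wn; have [ci lb] := lc_bond ij cn.
  rewrite /= ppart_loc// -lb ppart_loc//.
  rewrite (@rep_Tbond _ _ c _ _ _ _ ij _ gr)//.
  by have -> : foot (Yi j n) = n by exact: vs_foot.
have := is_diff_unique (near_is_diff near12 d1) d2.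
by move=> /(congr1 (fun f => f (u j))) /=; rewrite (pfunP u ij) => ->.
Qed.

Lemma rep_lfield (W : set (LM M)) (X : lfield W) c m : ldom c m ->
  exists u : LF M, forall i, u i = rep (X m i) (c i).
Proof.
by move=> cm; apply: rep_limit_ex; rewrite (ls_foot X m).
Qed.

(** The values D_i(X_i, Y_i)(m_i) form an element of the limit tangent bundle
    since Christoffel symbols and derivatives both commute with rho, and they
    do not depend on the families chosen for X and Y. *)
Lemma limit_connection (D : forall i, nabla_op (Mi i)) :
  (forall i, is_connection (D i)) ->
  (forall c, exists G, lim_conn_components D c G) ->
  exists N : lnabla_op M, is_lim_nabla N D.
Proof.
move=> Dconn DG.
have value (W : set (LM M)) (X Y : lfield W) : exists Z : lsection W,
    forall Wi (Xi Yi : forall i, vfield (Wi i)),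
    is_lim_field Xi X -> is_lim_field Yi Y ->
    forall m, W m -> forall i, Z m i = D i (Wi i) (Xi i) (Yi i) (m i).
  have [Wi [Xi [Yi [limX limY]]]] := common_fields X Y.
  have [WE bX XE] := limX; have [_ bY YE] := limY.
  pose f i (m : Mi i) : tangent (CM i) := D i (Wi i) (Xi i) (Yi i) m.
  have f_foot i (m : Mi i) : foot (f i m) = m by exact: vs_foot.
  have WW m : W m -> forall i, Wi i (m i) by rewrite {1}WE.
  have f_bond m : W m -> forall i j, (i <= j)%N ->
      graph (Tmor (bmor j i)) (f j (m j)) (f i (m i)).
    move=> Wm i j ij; have [c cm] := lchart_at m.
    have [G [Gi DGi [Gb _]]] := DG c.
    have [u uE] := rep_lfield X cm; have [v vE] := rep_lfield Y cm.
    have Wmi := WW m Wm.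
    apply: (@graph_Tbond _ _ c) => //; first by rewrite f_foot; exact: cm.
      by rewrite !f_foot LM_bond.
    rewrite /f (DGi i).2// (DGi j).2//.
    rewrite -!XE// -!YE// -!uE -!vE rhoB//.
    rewrite [X in X - _](diff_lim_field_bond u ij limY Wm cm); congr (_ - _).
    rewrite -(Gb i j ij _ (cm j)) (pfunP u ij) (pfunP v ij).
    by rewrite -(lc_bond ij (cm j)).2 LM_bond.
  exists (glue_lsection f_foot f_bond).
  move=> Wi' Xi' Yi' limX' limY' m Wm i; rewrite glue_lsectionE//.
  have [WE' _ XE'] := limX'; have [_ _ YE'] := limY'.
  have Wm' : Wi' i (m i) by move: Wm; rewrite {1}WE'.
  have [c cm] := lchart_at m; have [G [Gi DGi _]] := DG c.
  have [u uE] := rep_lfield X cm.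
  have fE := f_foot i (m i).
  apply: (@tangent_eq_in_chart _ _ _ _ (c i)).
  - by rewrite fE; apply/esym; exact: vs_foot.
  - by rewrite fE; exact: cm.
  have XEi : rep (Xi i (m i)) (c i) = u i by rewrite -XE// uE.
  have XEi' : rep (Xi' i (m i)) (c i) = u i by rewrite -XE'// uE.
  have YEi : Yi i (m i) = Yi' i (m i) by rewrite -YE// YE'.
  have e1 := (DGi i).2 _ (Xi i) (Yi i) (m i) (WW m Wm i) (cm i).
  have e2 := (DGi i).2 _ (Xi' i) (Yi' i) (m i) Wm' (cm i).
  rewrite XEi YEi in e1; rewrite XEi' in e2.
  have e := diff_lim_field_unique u i limY limY' Wm cm.
  by apply: (etrans e1); rewrite [X in X - _]e; exact: esym e2.
pose N : lnabla_op M := fun W X Y => projT1 (cid (value W X Y)).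
exists N => W X Y Wi Xi Yi limX limY m Wm i.
by rewrite /N; case: cid => Z ZP; exact: ZP limX limY m Wm i.
Qed.

End LimitManifold.

(** * The correspondence between connections and sprays *)

Section Correspondence.
Context {R : realType} (M : proj_manifold R).
Notation E := (mspace M).
Notation Mi i := (mani M i).
Notation CM i := (coords_of (mani M i)).
Notation bond j i := (@bond R M j i).
Notation bmor j i := (map_mor (bond j i)).
Implicit Types (c : lchart M) (m : LM M) (v : LT M) (N : lconnection M)
  (Z : lspray M).

Lemma symH2_subproof (B : H2 M) i j : (i <= j)%N ->
  bilin_bond (symB (B j)) (symB (B i)).
Proof.
move=> ij u v; rewrite !symBE rhoZ// rhoD//.
by rewrite !(pfunP B ij).
Qed.

Definition symH2 (B : H2 M) : H2 M := PLim (symH2_subproof B).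

(** Christoffel symbols of a connection need not be symmetric: the spray has
    their symmetrizations as components, with the same quadratic forms. *)
Lemma limit_spray (D : forall i, nabla_op (Mi i)) :
  (forall i, is_connection (D i)) ->
  (forall c, exists G, lim_conn_components D c G) ->
  exists Z, forall c G, lim_conn_components D c G ->
    forall v, ldom c (lfoot v) -> forall x, at_point c (lfoot v) x ->
    forall i, rep (Z v i) (c i) =
      (rep (v i) (c i), G x i (rep (v i) (c i)) (rep (v i) (c i))).
Proof.
move=> Dconn DG.
pose z i := projT1 (cid (connection_spray (Dconn i))).
have zspray i : is_spray (z i) by rewrite /z; case: cid => ? [].
have zE i (d : idx (CM i)) G : conn_components (D i) d G ->
    forall w : tangent (CM i), dom d (foot w) ->
    rep (z i w) d = (rep w d, G (loc d (foot w)) (rep w d) (rep w d)).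
  by rewrite /z; case: cid => ? [? +]; apply.
have zfoot i w : foot (z i w) = w by case: (zspray i) => + _; apply.
have zP v i j : (i <= j)%N -> graph (Tmor (Tmor (bmor j i))) (z j (v j)) (z i (v i)).
  move=> ij; have [c cv] := lchart_at (lfoot v); have [G [Gi DGi [Gb _]]] := DG c.
  have cvj : dom (c j) (foot (v j)) by exact: cv j.
  have cvi : dom (c i) (foot (v i)) by exact: cv i.
  have vij := pfunP v ij.
  apply: (@graph_TTbond _ _ c); rewrite ?zfoot//.
  rewrite (zE _ _ _ (DGi j))// (zE _ _ _ (DGi i))// [LHS]/= [RHS]/=.
  rewrite (rep_Tbond ij cvj vij) -(Gb i j ij _ cvj).
  have [/= <- _] := vij.
  by rewrite -(lc_bond ij cvj).2.
have Zlim : is_lim_spray (fun v => PLim (zP v)) z.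
  split=> // c; have [G [Gi DGi [Gb GE]]] := DG c.
  exists (fun i x => symB (Gi i x)), (fun x => symH2 (G x)); split=> [i|].
    exact: spray_components_sym (DGi i) (zE i _ _ (DGi i)).
  split=> [i j ij m cm u v|m cm x xm i]; last by rewrite /= (GE m cm x xm).
  by rewrite !symBE rhoZ// rhoD// !(Gb i j ij m cm).
exists (LSpray (ex_intro _ z Zlim)) => c G [Gi DGi [_ GE]] v cv x xv i.
rewrite (GE _ cv _ xv) xv.
exact: zE (DGi i) (v i) (cv i).
Qed.

Lemma ex_components N c : exists G, components N c G.
Proof.
by have [D ND] := nablaP N; have [_ _ /(_ c)[G DG]] := ND; exists G, D.
Qed.

Lemma components_unique N c G G' m x (u v : LF M) i :
  components N c G -> components N c G' -> ldom c m -> at_point c m x ->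
  G x i (u i) (v i) = G' x i (u i) (v i).
Proof.
move=> [D [_ ND _] DG] [D' [_ ND' _] DG'] cm xm.
exact: lim_conn_components_unique ND ND' DG DG' cm xm.
Qed.

Lemma assigned_in_components N Z :
  (forall c, exists2 G, components N c G &
    forall v, ldom c (lfoot v) -> forall x, at_point c (lfoot v) x ->
    forall i, rep (Z v i) (c i) =
      (rep (v i) (c i), G x i (rep (v i) (c i)) (rep (v i) (c i)))) ->
  assigned N Z.
Proof.
move=> NZ c G NG v cv x xv i; have [G' NG' ZG'] := NZ c.
have [u uE] := rep_limit_ex cv.
by rewrite (ZG' v cv x xv) -!uE (components_unique u u i NG' NG cv xv).
Qed.

Lemma zeta_foot Z v i : foot (Z v i) = v i.
Proof. by have [z [/(_ i)[zf _] -> _]] := zetaP Z; exact: zf. Qed.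

Lemma lspray_ext Z Z' : (forall v, zeta Z v = zeta Z' v) -> Z = Z'.
Proof.
case: Z Z' => [Z p] [Z' p'] /= /funext ZZ'; move: p p'; rewrite ZZ' => p p'.
by rewrite (Prop_irrelevance p p').
Qed.

Lemma lconnection_ext N N' :
  (forall W (X Y : lfield W), nabla N X Y = nabla N' X Y) -> N = N'.
Proof.
case: N N' => [N p] [N' p'] /= NN'.
have {}NN' : N = N'.
  apply: functional_extensionality_dep => W.
  by apply/funext => X; apply/funext => Y.
by move: p p'; rewrite NN' => p p'; rewrite (Prop_irrelevance p p').
Qed.

Lemma assigned_spray_unique N Z Z' : assigned N Z -> assigned N Z' -> Z = Z'.
Proof.
move=> NZ NZ'; apply: lspray_ext => v; apply: plim_ext => i.
have [c cv] := lchart_at (lfoot v); have [x xv] := at_point_ex cv.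
have [G NG] := ex_components N c.
apply: (@tangent_eq_in_chart _ (Tan (CM i)) _ _ (c i)).
- by rewrite !zeta_foot.
- by rewrite zeta_foot; exact: cv i.
- by rewrite (NZ c G NG v cv x xv) (NZ' c G NG v cv x xv).
Qed.

Lemma connection_assigned_spray N : exists Z, assigned N Z.
Proof.
have [D ND] := nablaP N; have [Dconn _ DG] := ND.
have [Z ZG] := limit_spray Dconn DG; exists Z.
apply: assigned_in_components => c; have [G DcG] := DG c.
by exists G; [exists D|exact: ZG].
Qed.

Lemma spray_torsion_free_connection Z :
  exists N, torsion_free N /\ assigned N Z.
Proof.
have [z [zspray ZE zG]] := zetaP Z.
pose D i := projT1 (cid (spray_connection (zspray i))).
have Dconn i : is_connection (D i) by rewrite /D; case: cid => ? [].
have DG i (d : idx (CM i)) G : spray_components (z i) d G ->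
    conn_components (D i) d G.
  by rewrite /D; case: cid => ? [? +]; apply.
have DlG c : exists G, lim_conn_components D c G.
  have [Gi [G [zGi GG]]] := zG c; exists G; exists Gi => // i; exact: DG.
have [N0 ND] := limit_connection Dconn DlG.
have N0P : is_lim_connection N0 D by [].
pose N := LConnection (ex_intro _ D N0P).
have NG c : exists2 G, components N c G &
    (forall m, ldom c m -> forall x, at_point c m x -> forall i (u v : E i),
       G x i u v = G x i v u) /\
    forall v, ldom c (lfoot v) -> forall x, at_point c (lfoot v) x ->
    forall i, rep (Z v i) (c i) =
      (rep (v i) (c i), G x i (rep (v i) (c i)) (rep (v i) (c i))).
  have [Gi [G [zGi GG]]] := zG c; exists G.
    by exists D => //; exists Gi => // i; exact: DG.
  have [_ GE] := GG; split=> [m cm x xm i u v|v cv x xv i].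
    by rewrite (GE m cm x xm) xm; have [_ + _] := zGi i; apply; exact: cm i.
  rewrite ZE (GE _ cv _ xv) xv; have [_ _] := zGi i; apply; exact: cv i.
exists N; split.
  move=> c G NcG m cm x xm u v i; have [G' NG' [G's _]] := NG c.
  rewrite (components_unique u v i NcG NG' cm xm).
  by rewrite (components_unique v u i NcG NG' cm xm) (G's m cm x xm).
by apply: assigned_in_components => c; have [G NcG [_ ZG]] := NG c; exists G.
Qed.

(** The spray gives the quadratic forms of the Christoffel symbols on F, since
    every vector of F is the value of a constant limit field; polarization
    gives the rest. *)
Lemma torsion_free_assigned_components N N' Z c G G' m x (u v : LF M) i :
  torsion_free N -> assigned N Z -> torsion_free N' -> assigned N' Z ->
  components N c G -> components N' c G' -> ldom c m -> at_point c m x ->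
  G x i (u i) (v i) = G' x i (u i) (v i).
Proof.
move=> tN aN tN' aN' NG NG' cm xm.
have diag (w : LF M) k : G x k (w k) (w k) = G' x k (w k) (w k).
  have [W WE] : exists W : LT M, lfoot W = m /\ forall j, rep (W j) (c j) = w j.
    have [X Xw] := const_lfield_ex c w; have [_ _ XE] := Xw.
    exists (X m); split=> [|j]; first exact: ls_foot.
    by rewrite XE// const_fieldE//; exact: cm j.
  have [Wm rW] := WE.
  have cW : ldom c (lfoot W) by rewrite Wm.
  have xW : at_point c (lfoot W) x by rewrite Wm.
  have := aN c G NG W cW x xW k; rewrite (aN' c G' NG' W cW x xW k) rW.
  by case.
have wP i' j' : (i' <= j')%N -> @rho R M j' i' (u j' + v j') = u i' + v i'.
  by move=> ij; rewrite rhoD// (pfunP u ij) (pfunP v ij).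
apply: (@polarization_at _ _ _ (fun p q => G x i p q) (fun p q => G' x i p q))
  => [w p q|w p q|w p q|w p q|||||].
- exact: clinD.
- by rewrite clinD.
- exact: clinD.
- by rewrite clinD.
- exact: tN NG m cm x xm u v i.
- exact: tN' NG' m cm x xm u v i.
- exact: diag.
- exact: diag.
- exact: (diag (PLim wP) i).
Qed.

Lemma torsion_free_connection_unique N N' Z :
  torsion_free N -> assigned N Z -> torsion_free N' -> assigned N' Z -> N = N'.
Proof.
move=> tN aN tN' aN'; apply: lconnection_ext => W X Y; apply: lsection_ext => m Wm.
have [c cm] := lchart_at m; have [x xm] := at_point_ex cm.
have [D ND] := nablaP N; have [D' ND'] := nablaP N'.
have [_ limN DG] := ND; have [_ limN' DG'] := ND'.
have [G GD] := DG c; have [G' GD'] := DG' c.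
have NG : components N c G by exists D.
have NG' : components N' c G' by exists D'.
have [Wi [Xi [Yi [limX limY]]]] := common_fields X Y.
have [WE _ XE] := limX; have [_ _ YE] := limY.
have Wmi i : Wi i (m i) by move: i; move: Wm; rewrite {1}WE.
have [u uE] := rep_lfield X cm; have [v vE] := rep_lfield Y cm.
apply: (@LT_ext _ _ _ _ c); first by rewrite !ls_foot.
  by rewrite ls_foot.
move=> i; rewrite (limN _ _ _ _ _ _ limX limY m Wm i).
rewrite (limN' _ _ _ _ _ _ limX limY m Wm i).
have [Gi DGi [_ GE]] := GD; have [Gi' DGi' [_ GE']] := GD'.
have e1 := (DGi i).2 _ (Xi i) (Yi i) (m i) (Wmi i) (cm i).
have e2 := (DGi' i).2 _ (Xi i) (Yi i) (m i) (Wmi i) (cm i).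
apply: (etrans e1); apply: (etrans _ (esym e2)); congr (_ - _).
rewrite -xm -(GE m cm x xm i) -(GE' m cm x xm i) -XE// -YE// -uE -vE.
exact: torsion_free_assigned_components tN aN tN' aN' NG NG' cm xm.
Qed.

(** In a chart, the lift of a smooth curve g has the derivative g' as principal
    part, which is again differentiable. *)
Lemma differentiable_velocity i (g : R -> Mi i) (V : R -> tangent (CM i)) (J : set R)
  (d : idx (CM i)) (t : R) : open J -> smooth_curve J g -> J t -> dom d (g t) ->
  (forall s, J s -> velocity (A := CM i) g s (V s)) ->
  differentiable (fun s => rep (V s) d : E i) t.
Proof.
move=> oJ [cg sg] Jt dt gV; pose f (s : R) : E i := loc d (g s).
have sf : smooth_on (J `&` g @^-1` cdom (sval d)) f by exact: sg (svalP d).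
have ddf : differentiable (Deriv f) t.
  by apply: smooth_on_differentiable (smooth_on_Deriv sf) _.
have d1 := is_diff_comp (is_diff_pair (differentiableP ddf) (is_diff_cst (1 : R) t))
  (is_diff_clin_app _).
apply: is_diff_differentiable; apply: near_is_diff d1.
have nd : \forall s \near t, dom d (g s).
  exact: near_preimage (cg t Jt) erefl (near_dom dt).
apply: filterS2 nd (open_nbhs_nbhs (conj oJ Jt)) => s ds Js.
have /is_derive1P dfs := (gV s Js).2 d ds.
rewrite /= DerivE; last exact: is_diff_differentiable dfs.
by have [_ ->] := dfs; rewrite scale1r.
Qed.

(** The geodesic equation is the second component of the equation for an
    integral curve of the spray in a limit chart, the first one saying that V
    lifts g.  One chart is enough, by the chain rule for TM. *)
Lemma geodesic_is_geodesic_spray N Z (J : set R) (g : R -> LM M) :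
  assigned N Z -> open J -> smooth_lcurve J g ->
  geodesic N J g -> geodesic_spray Z J g.
Proof.
move=> NZ oJ sg [V gV geo]; exists V => // t Jt i.
have Vfoot s k : J s -> foot (V s k) = g s k by move=> Js; case: (gV s Js k).
have Vg : lfoot (V t) = g t by apply: plim_ext => k; exact: Vfoot.
have [c ct] := lchart_at (g t); have [x xt] := at_point_ex ct.
have [G NG] := ex_components N c.
have cV : ldom c (lfoot (V t)) by rewrite Vg.
have xV : at_point c (lfoot (V t)) x by rewrite Vg.
have nJ : \forall s \near t, J s by exact: open_nbhs_nbhs.
have coh2 : coherent2 (CM i) := coherent_manifold (mani M i).
apply: (@velocity_in_chart _ (Tan (CM i)) _ _ _ (c i)).
- exact: coherent_Tan.
- exact: zeta_foot.
- exact: (cV i).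
- move=> d; change (idx (Tan (CM i))) with (idx (CM i)) in d => dt.
  rewrite /= Vfoot// in dt.
  have nd : \forall s \near t, dom d (g s i).
    exact: near_preimage ((sg i).1 t Jt) erefl (near_dom dt).
  by apply: filterS2 nJ nd => s Js ds; rewrite /= Vfoot.
- rewrite (NZ c G NG (V t) cV x xV); apply/is_derive1P.
  have d1 : is_diff t (fun s => loc (c i) (foot (V s i)) : E i)
      (fun h => h *: rep (V t i) (c i)).
    apply: (@near_is_diff _ _ _ (fun s => loc (c i) (g s i))).
      by apply: filterS nJ => s Js; rewrite Vfoot.
    exact/is_derive1P/(gV t Jt i).2/(ct i).
  have d2 : is_diff t (fun s => rep (V s i) (c i) : E i)
      (fun h => h *: G x i (rep (V t i) (c i)) (rep (V t i) (c i))).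
    have dV := differentiable_velocity oJ (sg i) Jt (ct i) (fun s Js => gV s Js i).
    apply/is_derive1P; split; first exact/derivable1_diffP.
    rewrite -derive1E; apply/eqP; rewrite -subr_eq0; apply/eqP.
    exact: geo NG t Jt ct x xt i.
  exact: is_diff_pair d1 d2.
Qed.

End Correspondence.

Theorem corollary7p3 (R : realType) (M : proj_manifold R) :
  [/\ forall N : lconnection M, exists! Z : lspray M, assigned N Z,
      forall Z : lspray M, exists! N : lconnection M,
        torsion_free N /\ assigned N Z
    & forall (N : lconnection M) (Z : lspray M), assigned N Z ->
        forall (eps : R) (g : R -> LM M), 0 < eps ->
          smooth_lcurve [set t | - eps < t < eps] g ->
          geodesic N [set t | - eps < t < eps] g ->
          geodesic_spray Z [set t | - eps < t < eps] g].
Proof.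
split=> [N|Z|N Z NZ eps g eps0].
- have [Z NZ] := connection_assigned_spray N.
  by exists Z; split=> // Z'; exact: assigned_spray_unique.
- have [N [tN aN]] := spray_torsion_free_connection Z.
  by exists N; split=> // N' [tN' aN']; exact: torsion_free_connection_unique aN tN' aN'.
- apply: geodesic_is_geodesic_spray => //.
  have -> : [set t | - eps < t < eps] = `](- eps), eps[%classic.
    by apply/seteqP; split=> t; rewrite /= in_itv.
  exact: interval_open.
Qed.
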